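(* Every 2D scattering diagram has a unique solution. Concretely: given an undecorated 2D scattering diagram with sets of labels $C_{in}$, $C_{out}$, there is a unique morphism of schemes $$s:\prod_{\gamma\in C_{in}}U_\gamma\longrightarrow\prod_{\gamma\in C_{out}}U_\gamma,\qquad (u_\gamma)_{\gamma\in C_{in}}\longmapsto(u'_\gamma)_{\gamma\in C_{out}},$$ such that the product over all incoming and outgoing rays, in clockwise order around the origin, $$\overrightarrow{\prod}\,(u_\gamma^{(\prime)})^{\pm1}=\mathrm{Id},$$ where an incoming ray labelled $\gamma$ contributes $u_\gamma^{-1}$ and an outgoing ray labelled $\gamma$ contributes $u'_\gamma$. Furthermore, for any decoration $(u_\gamma)_{\gamma\in C_{in}}$ of the incoming rays, $s((u_\gamma)_{\gamma\in C_{in}})$ is the unique tuple in $\prod_{\gamma\in C_{out}}U_\gamma$ of Stokes factors for the outgoing rays such that this clockwise-ordered product is the identity.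
   Context: $G$ is a reductive algebraic group over $\mathbb C$ with maximal torus $T$ and root system $\Phi$; $\mathfrak g_\gamma$ is the root space and $U_\gamma=\exp(\mathfrak g_\gamma)\subset G$ the root subgroup of $\gamma\in\Phi$. A set of roots $C$ is convex if there is a polarization $\Phi=\Phi_+\sqcup\Phi_-$ (a choice of positive and negative roots) with $C\subset\Phi_+$. For a convex set $\{\alpha_1,\dots,\alpha_j\}$, the restricted convex hull is $\mathrm{Conv}^{\mathbb N}_{\alpha_1,\dots,\alpha_j}=\{\gamma\in\Phi:\gamma=\sum_i n_i\alpha_i,\ n_i\in\mathbb Z_{\ge0}\}$. An undecorated 2D scattering diagram: a convex set $C_{in}\subset\Phi$, the set $C_{out}=\mathrm{Conv}^{\mathbb N}_{C_{in}}$, and a finite collection of distinct oriented rays in $\mathbb R^2$, each starting or ending at $0$, with a bijection between the incoming rays (ending at $0$) and $C_{in}$ and a bijection between the outgoing rays (starting at $0$) and $C_{out}$. Incoming and outgoing rays may be interspersed in any cyclic order. A solution is a morphism of schemes $\prod_{C_{in}}U_\alpha\to\prod_{C_{out}}U_\gamma$ such that the clockwise-ordered product above, over inputs and outputs, is the identity. (The condition does not depend on the ray at which the clockwise product is started.) *)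

(* Defs.v *)
From HB Require Import structures.
From mathcomp Require Import all_boot all_order all_algebra.
From mathcomp Require Import complex.
From mathcomp Require mpoly.
From mathcomp Require Import all_classical all_reals all_analysis.
Import -(notations) mpoly.
Import Order.TTheory GRing.Theory Num.Theory.
Import numFieldNormedType.Exports.
Set Implicit Arguments.
Unset Strict Implicit.
Unset Printing Implicit Defensive.
Local Open Scope classical_set_scope.
Local Open Scope ring_scope.

Definition Cplx (R : realType) : numClosedFieldType := R[i].

(** ** Affine varieties and regular functions

An affine algebraic group over the complex numbers is a Zariski-closed
subgroup of some GL_n; varieties are reduced and are given by their closed
points, so a morphism of varieties is a map whose coordinates are regular
functions.  Polynomials have their indeterminates indexed by a finite type
[K]. *)

Definition mpolynomial (R : realType) (K : finType) := mpoly #|K| (Cplx R).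

Definition peval (R : realType) (K : finType) (p : mpolynomial R K)
    (x : K -> Cplx R) : Cplx R :=
  meval (fun k => x (enum_val k)) p.

Definition mx_coords (R : realType) (n : nat) (A : 'M[Cplx R]_n)
    (k : 'I_n * 'I_n) : Cplx R := A k.1 k.2.

Definition mxs_coords (R : realType) (n : nat) (I : finType)
    (u : I -> 'M[Cplx R]_n) (k : I * ('I_n * 'I_n)) : Cplx R :=
  mx_coords (u k.1) k.2.

(* The coordinate ring of GL_n is C[x_ij][1/det], and a regular function on a
   closed subvariety of the affine variety GL_n is the restriction of one on
   GL_n; likewise for a product of copies of GL_n. *)
Definition regular_on_GL (R : realType) (n : nat) (X : set 'M[Cplx R]_n)
    (f : X -> Cplx R) : Prop :=
  exists (p : mpolynomial R ('I_n * 'I_n)%type) (e : nat),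
    forall x : X, f x = peval p (mx_coords (val x)) / \det (val x) ^+ e.

Definition regular_on_GLs (R : realType) (n : nat) (I : finType)
    (X : set (I -> 'M[Cplx R]_n)) (f : X -> Cplx R) : Prop :=
  exists (p : mpolynomial R (I * ('I_n * 'I_n))%type) (e : nat),
    forall x : X,
      f x = peval p (mxs_coords (val x)) / (\prod_i \det (val x i)) ^+ e.

Definition zariski_closed (R : realType) (n : nat) (Z : set 'M[Cplx R]_n) :
    Prop :=
  exists S : set (mpolynomial R ('I_n * 'I_n)%type),
    Z = [set A | A \in unitmx /\ forall p, S p -> peval p (mx_coords A) = 0].

Definition zariski_connected (R : realType) (n : nat)
    (X : set 'M[Cplx R]_n) : Prop :=
  forall Z1 Z2, zariski_closed Z1 -> zariski_closed Z2 ->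
    X `<=` Z1 `|` Z2 -> X `&` (Z1 `&` Z2) = set0 -> X `<=` Z1 \/ X `<=` Z2.

(** ** Algebraic groups *)

Definition algebraic_group (R : realType) (n : nat) (G : set 'M[Cplx R]_n) :
    Prop :=
  [/\ zariski_closed G,
      G 1%:M,
      forall A B, G A -> G B -> G (A *m B)
    & forall A, G A -> G (invmx A)].

Definition normal_in (R : realType) (n : nat) (H G : set 'M[Cplx R]_n) :
    Prop :=
  H `<=` G /\ forall A B, G A -> H B -> H (A *m B *m invmx A).

Definition unipotent (R : realType) (n : nat) (H : set 'M[Cplx R]_n) : Prop :=
  forall A, H A -> exists k : nat, (A - 1%:M) ^+ k = 0.

(* The unipotent radical is trivial.  G need not be connected. *)
Definition reductive (R : realType) (n : nat) (G : set 'M[Cplx R]_n) : Prop :=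
  algebraic_group G /\
  forall H, algebraic_group H -> normal_in H G -> zariski_connected H ->
    unipotent H -> H = [set 1%:M].

Definition group_hom (R : realType) (n m : nat) (H : set 'M[Cplx R]_n)
    (K : set 'M[Cplx R]_m) (f : H -> K) : Prop :=
  forall x y z : H, val z = val x *m val y ->
    val (f z) = val (f x) *m val (f y).

Definition regular_map (R : realType) (n m : nat) (H : set 'M[Cplx R]_n)
    (K : set 'M[Cplx R]_m) (f : H -> K) : Prop :=
  forall i j, regular_on_GL (fun x : H => val (f x) i j).

Definition diag_group (R : realType) (r : nat) : set 'M[Cplx R]_r :=
  [set A | is_diag_mx A /\ A \in unitmx].
Arguments diag_group : clear implicits.

(* An algebraic group isomorphic to (G_m)^r for some r. *)
Definition torus (R : realType) (n : nat) (T : set 'M[Cplx R]_n) : Prop :=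
  algebraic_group T /\
  exists (r : nat) (f : T -> diag_group R r) (g : diag_group R r -> T),
    [/\ regular_map f, regular_map g, cancel f g, cancel g f & group_hom f].

Definition maximal_torus (R : realType) (n : nat) (G T : set 'M[Cplx R]_n) :
    Prop :=
  [/\ torus T, T `<=` G
    & forall T', torus T' -> T' `<=` G -> T `<=` T' -> T' = T].

(* The tangent space of G at the identity: the common kernel of the
   differentials at 1 of the polynomials vanishing on G. *)
Definition lie_algebra (R : realType) (n : nat) (G : set 'M[Cplx R]_n) :
    set 'M[Cplx R]_n :=
  [set X | forall p : mpolynomial R ('I_n * 'I_n)%type,
     (forall A, G A -> peval p (mx_coords A) = 0) ->
     \sum_k peval (mderiv (enum_rank k) p) (mx_coords 1%:M) * mx_coords X k
       = 0].

(** ** Roots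

The character group is written multiplicatively, as functions on T; an
integer combination of characters is thus a product of powers. *)

Definition is_character (R : realType) (n : nat) (T : set 'M[Cplx R]_n)
    (chi : T -> Cplx R) : Prop :=
  [/\ regular_on_GL chi,
      forall t, chi t != 0
    & forall x y z : T, val z = val x *m val y -> chi z = chi x * chi y].

Definition root_space (R : realType) (n : nat) (G T : set 'M[Cplx R]_n)
    (gamma : T -> Cplx R) : set 'M[Cplx R]_n :=
  [set X | lie_algebra G X /\
     forall t : T, val t *m X *m invmx (val t) = gamma t *: X].

Definition root_system (R : realType) (n : nat) (G T : set 'M[Cplx R]_n) :
    set (T -> Cplx R) :=
  [set gamma | [/\ is_character gamma, gamma <> (fun=> 1)
     & exists2 X, root_space G gamma X & X != 0]].

Definition mx_exp (R : realType) (n : nat) (X : 'M[Cplx R]_n) :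
    'M[Cplx R]_n :=
  \matrix_(i, j)
    limn (fun N => \sum_(0 <= k < N) (X ^+ k) i j / k`!%:R).

Definition root_subgroup (R : realType) (n : nat) (G T : set 'M[Cplx R]_n)
    (gamma : T -> Cplx R) : set 'M[Cplx R]_n :=
  @mx_exp R n @` root_space G gamma.

(* A polarization is given by a real linear form on the character lattice that
   vanishes on no root: the positive roots are those on which it is
   positive. *)
Definition polarization (R : realType) (n : nat) (G T : set 'M[Cplx R]_n)
    (Phi_pos Phi_neg : set (T -> Cplx R)) : Prop :=
  exists l : (T -> Cplx R) -> R,
    [/\ forall chi psi, is_character chi -> is_character psi ->
          l (fun t => chi t * psi t) = l chi + l psi,
        forall alpha, root_system G alpha -> l alpha != 0,
        Phi_pos = [set alpha | root_system G alpha /\ 0 < l alpha]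
      & Phi_neg = [set alpha | root_system G alpha /\ l alpha < 0]].

Definition convex_roots (R : realType) (n : nat) (G T : set 'M[Cplx R]_n)
    (C : set (T -> Cplx R)) : Prop :=
  exists Phi_pos Phi_neg, polarization G Phi_pos Phi_neg /\ C `<=` Phi_pos.

(* The roots of the form sum_i m_i alpha_i with natural numbers m_i. *)
Definition restricted_convex_hull (R : realType) (n : nat)
    (G T : set 'M[Cplx R]_n) (I : finType) (alpha : I -> (T -> Cplx R)) :
    set (T -> Cplx R) :=
  [set gamma | root_system G gamma /\
     exists m : I -> nat, forall t, gamma t = \prod_i alpha i t ^+ m i].

(** ** Scattering diagrams *)

(* [incoming] and [outgoing] are the sets of rays; C_in is the range of
   [in_label] and C_out that of [out_label].  The support of a ray is given by
   its polar angle theta, i.e. it is {(r cos theta, r sin theta) | r >= 0}. *)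
Record scattering_diagram (R : realType) (n : nat)
    (G T : set 'M[Cplx R]_n) := ScatteringDiagram {
  incoming : finType;
  outgoing : finType;
  in_label : incoming -> (T -> Cplx R);
  out_label : outgoing -> (T -> Cplx R);
  in_label_inj : injective in_label;
  in_label_convex : convex_roots G (range in_label);
  out_label_inj : injective out_label;
  out_label_range : range out_label = restricted_convex_hull G in_label;
  angle : incoming + outgoing -> R;
  angle_itv : forall r, 0 <= angle r < 2 * pi;
  angle_inj : injective angle
}.
Arguments in_label {R n G T} s _ _.
Arguments out_label {R n G T} s _ _.

Definition root_subgroup_prod (R : realType) (n : nat)
    (G T : set 'M[Cplx R]_n) (I : finType) (label : I -> (T -> Cplx R)) :
    set (I -> 'M[Cplx R]_n) :=
  [set u | forall i, root_subgroup G (label i) (u i)].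

(* The product of the U_gamma over gamma in C_in, resp. in C_out. *)
Definition in_decoration (R : realType) (n : nat) (G T : set 'M[Cplx R]_n)
    (D : scattering_diagram G T) : set (incoming D -> 'M[Cplx R]_n) :=
  root_subgroup_prod G (in_label D).
Arguments in_decoration {R n G T} D _.

Definition out_decoration (R : realType) (n : nat) (G T : set 'M[Cplx R]_n)
    (D : scattering_diagram G T) : set (outgoing D -> 'M[Cplx R]_n) :=
  root_subgroup_prod G (out_label D).
Arguments out_decoration {R n G T} D _.

(* Clockwise means by decreasing angle.  The listing starts with the first ray
   met clockwise after the positive x-axis; starting elsewhere conjugates the
   product below, and so does not affect whether it is the identity. *)
Definition clockwise_rays (R : realType) (n : nat) (G T : set 'M[Cplx R]_n)
    (D : scattering_diagram G T) : seq (incoming D + outgoing D) :=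
  sort (fun r r' => angle r' <= angle r) (enum {: incoming D + outgoing D}).

Definition clockwise_product (R : realType) (n : nat)
    (G T : set 'M[Cplx R]_n) (D : scattering_diagram G T)
    (u : in_decoration D) (u' : out_decoration D) : 'M[Cplx R]_n :=
  \big[mulmx/1%:M]_(r <- clockwise_rays D)
    match r with
    | inl i => invmx (val u i)
    | inr j => val u' j
    end.

(* The root subgroups are closed in GL_n, so that both products are affine
   varieties. *)
Definition is_morphism (R : realType) (n : nat) (G T : set 'M[Cplx R]_n)
    (D : scattering_diagram G T) (s : in_decoration D -> out_decoration D) :
    Prop :=
  forall j k l, regular_on_GLs (fun u : in_decoration D => val (s u) j k l).

Definition is_solution (R : realType) (n : nat) (G T : set 'M[Cplx R]_n)
    (D : scattering_diagram G T) (s : in_decoration D -> out_decoration D) :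
    Prop :=
  is_morphism s /\ forall u, clockwise_product u (s u) = 1%:M.

(* Main.v *)
Require Import Defs.
From mathcomp Require Import all_boot all_order all_algebra.
From mathcomp Require Import complex ring.
From mathcomp Require mpoly.
From mathcomp Require Import all_classical all_reals all_analysis.
Import -(notations) mpoly.
Import Order.TTheory GRing.Theory Num.Theory.
Import numFieldNormedType.Exports.
Set Implicit Arguments.
Unset Strict Implicit.
Unset Printing Implicit Defensive.
Local Open Scope classical_set_scope.
Local Open Scope ring_scope.

(** Why the theorem holds.

Write every Stokes factor as the exponential of its logarithm: an incoming
factor is exp (X_i) with X_i in a root space and contributes exp (- X_i), an
outgoing one contributes exp (X_j).  Expanding all the exponentials, the
clockwise product becomes a finite sum of noncommutative monomials in the
logarithms, and conjugation by the torus scales each monomial by the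
corresponding product of roots.  Collect the monomials by character.  A real
linear form l that is positive on C_in is positive on C_out too, and additive,
so the component of the product along the character of the outgoing ray j is

  X_j + (an expression in the X_i of incoming rays and in those X_r of outgoing
         rays for which l is smaller than at j),

see [component_labE] and [monomial_char_lower].

Uniqueness.  Matrices of distinct weights are linearly independent
([weight_independent]), so a product equal to 1 has all these components zero.
This triangular system has exactly one solution ([triangular_fixpoint_unique]).

Existence.  Solve the same system by recursion ([scattered_logs]).  It remains
to see that each X_j found in this way lies in the Lie algebra of G, and that
the components along the other characters vanish too.  Both follow from one
fact, [leading_component_in_lie]: if P is a product of exponentials as above,
then P is in G, so log P is in the Lie algebra of G; a weight component of P - 1
of lowest l is also a weight component of log P, since the higher powers of
P - 1 only involve larger values of l; and the Lie algebra, being stable under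
conjugation by the torus, contains the weight components of its elements
([weight_component]).  A nonzero lowest component therefore makes its character
a root, hence a label of an outgoing ray, and along those labels the component
vanishes by construction.

The two facts linking G and its Lie algebra, [texp_in_group] and
[tlog_in_lie_algebra], are proved with polynomials in one variable: the
functions s |-> f (exp (s X)) and s |-> f (P ^ s) are polynomial in s whenever
X and P - 1 are nilpotent and f is a polynomial on matrices.  All the matrices
involved are nilpotent, because a long product of matrices of positive weight
would have too many linearly independent partial products ([long_word_eq0]).

Regularity.  Logarithm, recursion and exponential are polynomial in the entries
of the incoming factors. *)

(** * Polynomials along polynomial curves *)

Lemma poly_eq_nat (F : numFieldType) (p q : {poly F}) :
  (forall m : nat, p.[m%:R] = q.[m%:R]) -> p = q.
Proof.
move=> pq; apply/eqP; rewrite -subr_eq0; apply/eqP.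
set r := p - q; pose rs : seq F := [seq m%:R | m <- iota 0 (size r)].
apply: (roots_geq_poly_eq0 (rs := rs)).
- by apply/allP => x /mapP[m _ ->]; rewrite /root /r !hornerE pq subrr.
- rewrite map_inj_uniq ?iota_uniq // => a b /eqP.
  by rewrite eqr_nat => /eqP.
- by rewrite size_map size_iota.
Qed.

Section Calculus.
Variables (R : realType).
Local Notation C := (Cplx R).

(** Induction over the ring operations, rather than over sums of monomials, so that
derivations only have to be compared on the indeterminates. *)
Lemma mpoly_ring_ind (K : finType) (P : mpolynomial R K -> Prop) :
  (forall c, P (mpolyC _ c)) -> (forall i, P (mpolyX _ (mnm1 i))) ->
  (forall p q, P p -> P q -> P (p + q)) ->
  (forall p q, P p -> P q -> P (p * q)) -> forall p, P p.
Proof.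
move=> PC PX PD PM p.
have P1 : P 1 by rewrite -mpolyC1; apply: PC.
elim/mpolyind: p; first by rewrite -mpolyC0; apply: PC.
move=> c m p _ _ Pp; apply: PD => //; rewrite -mul_mpolyC; apply: (PM) => //.
rewrite mpolyXE_id; apply: (big_ind P P1 PM) => i _.
elim: (m i) => [|e IH]; first by rewrite expr0.
by rewrite exprS; apply: (PM).
Qed.

Lemma pevalD (K : finType) (p q : mpolynomial R K) x :
  peval (p + q) x = peval p x + peval q x.
Proof. exact: mevalD. Qed.

Lemma pevalM (K : finType) (p q : mpolynomial R K) x :
  peval (p * q) x = peval p x * peval q x.
Proof. exact: mevalM. Qed.

Lemma pevalC (K : finType) c (x : K -> C) : peval (mpolyC _ c) x = c.
Proof. exact: mevalC. Qed.

Lemma pevalX (K : finType) i (x : K -> C) :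
  peval (mpolyX _ (mnm1 i)) x = x (enum_val i).
Proof. exact: mevalXU. Qed.

Lemma peval_sum (K I : finType) (p : I -> mpolynomial R K) x :
  peval (\sum_i p i) x = \sum_i peval (p i) x.
Proof. by rewrite /peval raddf_sum. Qed.

Lemma peval_ext (K : finType) (p : mpolynomial R K) x y :
  x =1 y -> peval p x = peval p y.
Proof. by move=> xy; apply: meval_eq => i; apply: xy. Qed.

Lemma peval_chain_rule (K : finType) (p : mpolynomial R K)
    (w : K -> {poly C}) :
  exists q : {poly C}, forall s,
    q.[s] = peval p (fun k => (w k).[s]) /\
    q^`().[s] = \sum_k peval (mderiv (enum_rank k) p) (fun k => (w k).[s]) *
                       (w k)^`().[s].
Proof.
elim/mpoly_ring_ind: p => [c|i|p q [p' Hp] [q' Hq]|p q [p' Hp] [q' Hq]].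
- exists c%:P => s; rewrite hornerC pevalC derivC hornerC; split=> //.
  by rewrite big1 // => k _; rewrite mderivC -mpolyC0 pevalC mul0r.
- exists (w (enum_val i)) => s; rewrite pevalX; split=> //.
  rewrite (bigD1 (enum_val i)) //= big1 ?addr0.
    rewrite enum_valK mderivX mnm1E eqxx scale1r.
    rewrite (_ : mnm_sub (mnm1 i) (mnm1 i) = mnm0); last first.
      by apply/mnmP => j; rewrite !mnmE subnn.
    by rewrite mpolyX0 -mpolyC1 pevalC mul1r.
  move=> k /eqP ki; rewrite mderivX mnm1E; case: eqP => [ik|_].
    by case: ki; rewrite ik enum_rankK.
  by rewrite scale0r -mpolyC0 pevalC mul0r.
- exists (p' + q') => s; have [Hp1 Hp2] := Hp s; have [Hq1 Hq2] := Hq s.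
  rewrite derivD 2!hornerD Hp1 Hq1 Hp2 Hq2.
  split; first by rewrite pevalD.
  rewrite -big_split /=.
  by apply: eq_bigr => k _; rewrite mderivD pevalD mulrDl.
- exists (p' * q') => s; have [Hp1 Hp2] := Hp s; have [Hq1 Hq2] := Hq s.
  rewrite derivM hornerD 3!hornerM Hp1 Hq1 Hp2 Hq2.
  split; first by rewrite pevalM.
  rewrite mulr_suml mulr_sumr -big_split /=.
  apply: eq_bigr => k _; rewrite mderivM pevalD 2!pevalM mulrDl.
  by rewrite mulrAC mulrA.
Qed.

(** * Directional derivatives and the Lie algebra *)

Section Matrices.
Variables (n : nat).
Implicit Types (A B X Y g h : 'M[C]_n) (W : 'M[{poly C}]_n).
Implicit Types (p q : mpolynomial R ('I_n * 'I_n)%type) (G : set 'M[C]_n).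

Definition vanishes_on G p := forall A, G A -> peval p (mx_coords A) = 0.

Definition ddir p A B :=
  \sum_k peval (mderiv (enum_rank k) p) (mx_coords A) * mx_coords B k.

Lemma lie_algebraE G X : lie_algebra G X <->
  forall p, vanishes_on G p -> ddir p 1%:M X = 0.
Proof. by []. Qed.

Lemma ddirD p A B B' : ddir p A (B + B') = ddir p A B + ddir p A B'.
Proof.
by rewrite /ddir -big_split; apply: eq_bigr => k _; rewrite /mx_coords mxE mulrDr.
Qed.

Lemma ddirZ p A a B : ddir p A (a *: B) = a * ddir p A B.
Proof.
rewrite /ddir mulr_sumr; apply: eq_bigr => k _.
by rewrite /mx_coords mxE mulrCA.
Qed.

Lemma lie_algebraD G X Y :
  lie_algebra G X -> lie_algebra G Y -> lie_algebra G (X + Y).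
Proof.
move=> /lie_algebraE LX /lie_algebraE LY; apply/lie_algebraE => p vp.
by rewrite ddirD LX // LY // addr0.
Qed.

Lemma lie_algebraZ G a X : lie_algebra G X -> lie_algebra G (a *: X).
Proof.
move=> /lie_algebraE LX; apply/lie_algebraE => p vp.
by rewrite ddirZ LX // mulr0.
Qed.

Lemma lie_algebra0 G : lie_algebra G 0.
Proof.
by apply/lie_algebraE => p _; rewrite -(scale0r 0) ddirZ mul0r.
Qed.

(** A matrix of polynomials in s is a polynomial curve in the space of
matrices. *)
Definition curve W (s : C) : 'M[C]_n := map_mx (horner^~ s) W.
Definition velocity W := map_mx (@deriv C) W.

Lemma curve_chain_rule p W : exists q : {poly C}, forall s,
  q.[s] = peval p (mx_coords (curve W s)) /\
  q^`().[s] = ddir p (curve W s) (curve (velocity W) s).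
Proof.
have [q Hq] := peval_chain_rule p (fun k => W k.1 k.2).
exists q => s; have [-> ->] := Hq s; split.
  by apply: peval_ext => k; rewrite /mx_coords mxE.
apply: eq_bigr => k _; congr (_ * _); last by rewrite /mx_coords !mxE.
by apply: peval_ext => j; rewrite /mx_coords mxE.
Qed.

Lemma line_chain_rule p A B : exists q : {poly C},
  (forall s, q.[s] = peval p (mx_coords (A + s *: B))) /\
  q^`().[0] = ddir p A B.
Proof.
pose W := \matrix_(i, j) ((A i j)%:P + 'X * (B i j)%:P).
have WE s : curve W s = A + s *: B.
  by apply/matrixP => i j; rewrite !mxE !hornerE.
have VE : curve (velocity W) 0 = B.
  apply/matrixP => i j; rewrite !mxE derivD derivM derivX !derivC.
  by rewrite !hornerE.
have [q Hq] := curve_chain_rule p W; exists q; split=> [s|].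
  by rewrite (Hq s).1 WE.
by rewrite (Hq 0).2 WE VE scale0r addr0.
Qed.

(** Left translations, right translations and conjugations of matrices all have this
form, so that the ideal of G is stable under the corresponding substitutions. *)
Lemma lin_subst p g h : exists q, forall A,
  peval q (mx_coords A) = peval p (mx_coords (g *m A *m h)).
Proof.
pose c (k : 'I_#|{: 'I_n * 'I_n}|) : mpolynomial R ('I_n * 'I_n)%type :=
  \sum_a \sum_b mpolyC _ (g (enum_val k).1 b * h a (enum_val k).2) *
    mpolyX _ (mnm1 (enum_rank (b, a))).
exists (comp_mpoly [tuple c k | k < #|{: 'I_n * 'I_n}|] p) => A.
rewrite /peval comp_mpoly_meval; apply: meval_eq => k; rewrite tnth_mktuple.
rewrite -[LHS]/(peval (c k) _) peval_sum /mx_coords mxE.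
apply: eq_bigr => a _; rewrite peval_sum mxE mulr_suml.
apply: eq_bigr => b _; rewrite pevalM pevalC pevalX enum_rankK /=.
by rewrite mulrAC.
Qed.

(** Both sides are the derivative at s = 0 of the same polynomial function of s,
obtained along the line A + s B. *)
Lemma ddir_lin_subst p q g h A B :
  (forall A, peval q (mx_coords A) = peval p (mx_coords (g *m A *m h))) ->
  ddir q A B = ddir p (g *m A *m h) (g *m B *m h).
Proof.
move=> pq; have [r [Hr <-]] := line_chain_rule q A B.
have [r' [Hr' <-]] := line_chain_rule p (g *m A *m h) (g *m B *m h).
suff -> : r = r' by [].
apply: poly_eq_nat => m; rewrite Hr Hr' pq.
by rewrite mulmxDr mulmxDl -scalemxAr -scalemxAl.
Qed.

Lemma lie_algebra_conj G t X : algebraic_group G -> G t ->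
  lie_algebra G X -> lie_algebra G (t *m X *m invmx t).
Proof.
move=> [Gz G1 GM GV] Gt /lie_algebraE LX; apply/lie_algebraE => p vp.
have [q Hq] := lin_subst p t (invmx t).
have tU : t \in unitmx by case: Gz Gt => S ->; case.
rewrite -[1%:M](mulmxV tU) -[X in _ *m X](mul1mx (invmx t)) mulmxA.
rewrite -(ddir_lin_subst _ _ Hq); apply: LX => A GA; rewrite Hq.
by apply: vp; apply: (GM); [apply: (GM)|apply: GV].
Qed.

(** The left-invariant vector field A |-> A X defined by X in the Lie algebra is
tangent to G at each of its points, by translation from the identity; hence the
corresponding derivation preserves the ideal of G. *)
Lemma vanishes_on_left_derivative G p X : algebraic_group G ->
  lie_algebra G X -> vanishes_on G p ->
  exists2 q, vanishes_on G q &
    forall A, peval q (mx_coords A) = ddir p A (A *m X).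
Proof.
move=> [_ G1 GM _] /lie_algebraE LX vp.
pose c (k : 'I_n * 'I_n) : mpolynomial R ('I_n * 'I_n)%type :=
  \sum_a mpolyX _ (mnm1 (enum_rank (k.1, a))) * mpolyC _ (X a k.2).
have cE A : peval (\sum_k mderiv (enum_rank k) p * c k) (mx_coords A) =
    ddir p A (A *m X).
  rewrite peval_sum; apply: eq_bigr => k _; rewrite pevalM; congr (_ * _).
  rewrite peval_sum /mx_coords mxE; apply: eq_bigr => a _.
  by rewrite pevalM pevalX pevalC enum_rankK.
exists (\sum_k mderiv (enum_rank k) p * c k) => // A GA; rewrite cE.
have [q Hq] := lin_subst p A 1%:M.
rewrite -[A *m X]mulmx1 -{1}[A]mulmx1 -[A *m 1%:M]mulmx1.
rewrite -(ddir_lin_subst _ _ Hq); apply: LX => B GB; rewrite Hq mulmx1.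
by apply: vp; apply: GM.
Qed.

End Matrices.
End Calculus.

(** * Truncated exponential and logarithm of matrices *)

Lemma sum_ord_trunc (V : nmodType) (F : nat -> V) a b :
  (a <= b)%N -> (forall k, (a <= k)%N -> F k = 0) ->
  \sum_(k < b) F k = \sum_(k < a) F k.
Proof.
move=> ab F0; rewrite -!(big_mkord xpredT F) (big_cat_nat (n := a)) //=.
rewrite [X in _ + X]big_nat_cond [X in _ + X]big1 ?addr0 // => k.
by rewrite andbT => /andP[/F0].
Qed.

(** [scalerAl] speaks of nontrivial rings, which excludes matrices of size 0. *)
Lemma mx_scalerAl (F : comNzRingType) n a (A B : 'M[F]_n) :
  a *: (A * B) = (a *: A) * B.
Proof. exact: scalemxAl. Qed.

Lemma mx_scalerAr (F : comNzRingType) n a (A B : 'M[F]_n) :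
  a *: (A * B) = A * (a *: B).
Proof. exact: scalemxAr. Qed.

Lemma mx_exprZn (F : comNzRingType) n a (A : 'M[F]_n) k :
  (a *: A) ^+ k = a ^+ k *: A ^+ k.
Proof.
elim: k => [|k IH]; first by rewrite scale1r.
by rewrite !exprS IH -mx_scalerAl -mx_scalerAr scalerA.
Qed.

Section ExpLog.
Variables (F : numFieldType) (N : nat).

(** The series exp (a 'X), truncated below degree N. *)
Definition exp_poly (a : F) : {poly F} := \poly_(i < N) (a ^+ i / i`!%:R).

Lemma exp_polyD a b k : (k < N)%N ->
  (exp_poly a * exp_poly b)`_k = (exp_poly (a + b))`_k.
Proof.
move=> kN; rewrite coefM coef_poly kN addrC exprDn mulr_suml.
apply: eq_bigr => -[j /=]; rewrite ltnS => jk _.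
rewrite !coef_poly (leq_ltn_trans jk kN) (leq_ltn_trans (leq_subr j k) kN).
rewrite -(bin_fact jk) natrM.
have f0 m : (m`!%:R : F) != 0 by rewrite pnatr_eq0 -lt0n fact_gt0.
have C0 : ('C(k, j)%:R : F) != 0 by rewrite pnatr_eq0 -lt0n bin_gt0.
rewrite natrM -mulr_natr.
by field; rewrite !f0 C0.
Qed.

(** The binomial coefficient s(s - 1)...(s - k + 1)/k! as a polynomial in s. *)
Definition binomial_poly k : {poly F} :=
  k`!%:R^-1 *: \prod_(i < k) ('X - i%:R%:P).

Lemma binomial_poly_nat k (m : nat) : (binomial_poly k).[m%:R] = 'C(m, k)%:R.
Proof.
have f0 : (k`!%:R : F) != 0 by rewrite pnatr_eq0 -lt0n fact_gt0.
apply: (mulfI f0); rewrite hornerZ mulVKf // -natrM mulnC bin_ffact.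
rewrite horner_prod; have [mk|km] := ltnP m k.
  rewrite ffact_small // (bigD1 (Ordinal mk)) //=.
  by rewrite !hornerE subrr mul0r.
rewrite ffact_prod natr_prod; apply: eq_bigr => i _.
by rewrite !hornerE natrB // ltnW // (leq_trans (ltn_ord i) km).
Qed.

Lemma binomial_poly0 : binomial_poly 0 = 1.
Proof. by rewrite /binomial_poly big_ord0 invr1 scale1r. Qed.

Lemma binomial_poly1 : binomial_poly 1 = 'X.
Proof. by rewrite /binomial_poly big_ord1 invr1 scale1r subr0. Qed.

Variables (n : nat).
Implicit Types (P X Z : 'M[F]_n).

Definition texp X : 'M[F]_n := \sum_(a < N) a`!%:R^-1 *: X ^+ a.

(** The derivative at s = 0 of P ^ s = sum_k binomial (s, k) (P - 1) ^ k, which is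
the truncated logarithm series: the coefficient of (P - 1) ^ k is
(- 1) ^ (k - 1) / k for k > 0. *)
Definition tlog P : 'M[F]_n :=
  \sum_(k < N) (binomial_poly k)^`().[0] *: (P - 1) ^+ k.

Lemma nilp_ge X k : X ^+ N = 0 -> (N <= k)%N -> X ^+ k = 0.
Proof. by move=> X0 Nk; rewrite -(subnK Nk) exprD X0 mulr0. Qed.

(** The curve s |-> P ^ s; it interpolates the powers of P when P is unipotent. *)
Definition power_flow P : 'M[{poly F}]_n :=
  \matrix_(i, j) \sum_(k < N) ((P - 1) ^+ k) i j *: binomial_poly k.

(** The curve s |-> exp (s X). *)
Definition exp_flow X : 'M[{poly F}]_n :=
  \matrix_(i, j) \sum_(k < N) (k`!%:R^-1 * (X ^+ k) i j) *: 'X^k.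

Lemma power_flow_nat P (m : nat) : (P - 1) ^+ N = 0 ->
  map_mx (horner^~ m%:R) (power_flow P) = P ^+ m.
Proof.
set Z := P - 1 => Z0; have -> : P = Z + 1 by rewrite subrK.
rewrite exprD1n.
transitivity (\sum_(k < N) Z ^+ k *+ 'C(m, k)).
  apply/matrixP => i j; rewrite !mxE horner_sum summxE.
  apply: eq_bigr => k _; rewrite hornerZ binomial_poly_nat mulr_natr.
  by rewrite mulmxnE addrK.
rewrite -(@sum_ord_trunc _ (fun k => Z ^+ k *+ 'C(m, k)) N (m.+1 + N)%N).
- apply: (@sum_ord_trunc _ (fun k => Z ^+ k *+ 'C(m, k))).
    exact: leq_addr.
  by move=> k mk; rewrite bin_small.
- exact: leq_addl.
- by move=> k Nk; rewrite nilp_ge // mul0rn.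
Qed.

Lemma power_flow_velocity P :
  map_mx (horner^~ 0) (map_mx (@deriv F) (power_flow P)) = tlog P.
Proof.
apply/matrixP => i j; rewrite !mxE raddf_sum horner_sum summxE.
by apply: eq_bigr => k _ /=; rewrite derivZ hornerZ [in RHS]mxE [LHS]mulrC.
Qed.

Lemma exp_flowE X s : map_mx (horner^~ s) (exp_flow X) = texp (s *: X).
Proof.
apply/matrixP => i j; rewrite !mxE horner_sum summxE.
apply: eq_bigr => k _; rewrite hornerZ hornerXn mx_exprZn !mxE.
by rewrite mulrAC mulrA.
Qed.

Lemma exp_flow_velocity X s : X ^+ N = 0 ->
  map_mx (horner^~ s) (map_mx (@deriv F) (exp_flow X)) = texp (s *: X) * X.
Proof.
move=> X0.
transitivity (\sum_(k < N) (s ^+ k.-1 *+ k / k`!%:R) *: X ^+ k).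
  apply/matrixP => i j; rewrite !mxE raddf_sum horner_sum summxE.
  apply: eq_bigr => k _ /=.
  rewrite derivZ hornerZ derivXn hornerMn hornerXn !mxE.
  by rewrite [LHS]mulrC mulrA.
rewrite /texp mulr_suml; move: X0; case: N => [|N'] X0; first by rewrite !big_ord0.
rewrite big_ord_recl big_ord_recr /= mulr0n mul0r scale0r add0r.
rewrite mx_exprZn -!mx_scalerAl -exprSr X0 !scaler0 addr0.
apply: eq_bigr => k _; rewrite mx_exprZn -!mx_scalerAl -exprSr scalerA.
congr (_ *: _); rewrite factS natrM invfM -mulr_natr /=.
have k0 : (k.+1%:R : F) != 0 by rewrite pnatr_eq0.
by rewrite mulrA mulfK // mulrC.
Qed.

End ExpLog.

(** In polynomials, exp (a 'X) exp (b 'X) and exp ((a + b) 'X) have the same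
coefficients below degree N, hence the same value at a matrix with X ^ N = 0. *)
Lemma texpD (F : numFieldType) N n (X : 'M[F]_n) a b : X ^+ N = 0 ->
  texp N (a *: X) * texp N (b *: X) = texp N ((a + b) *: X).
Proof.
case: n X => [|n] X X0; first by rewrite [LHS]thinmx0 [RHS]thinmx0.
have texpE c : texp N (c *: X) = horner_mx X (exp_poly N c).
  rewrite /exp_poly poly_def rmorph_sum /=; apply: eq_bigr => i _.
  rewrite -mul_polyC rmorphM rmorphXn /= horner_mx_X horner_mx_C mx_exprZn.
  by rewrite scalerA [_^-1 * _]mulrC -mulmxE mul_scalar_mx.
rewrite !texpE -rmorphM /=; apply/eqP; rewrite -subr_eq0 -rmorphB /=.
rewrite -[X in horner_mx _ X](poly_take_drop N) rmorphD rmorphM /= rmorphXn /=.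
rewrite horner_mx_X X0 mulr0 addr0.
rewrite (_ : take_poly N _ = 0) ?rmorph0 //; apply/polyP => k.
rewrite coef_take_poly coef0; case: ifP => // kN.
by rewrite coefB exp_polyD // subrr.
Qed.

Section ExpLogInverse.
Variables (F : numFieldType) (N n : nat).
Implicit Types (P X Z : 'M[F]_n).
Hypothesis N_gt1 : (1 < N)%N.

Lemma texp0 : texp N (0 : 'M[F]_n) = 1.
Proof.
rewrite /texp; case: N N_gt1 => // N' _.
rewrite big_ord_recl /= invr1 scale1r big1 ?addr0 // => k _.
by rewrite exprS mul0r scaler0.
Qed.

Lemma texpNr X : X ^+ N = 0 -> texp N X * texp N (- X) = 1.
Proof.
move=> X0; rewrite -[X in texp N X * _]scale1r -scaleN1r texpD //.
by rewrite subrr scale0r texp0.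
Qed.

Lemma texp_nat X (m : nat) : X ^+ N = 0 ->
  texp N (m%:R *: X) = texp N X ^+ m.
Proof.
move=> X0; elim: m => [|m IH]; first by rewrite scale0r texp0.
by rewrite exprS -IH -[X in texp N X * _]scale1r texpD // -natr1 addrC.
Qed.

Lemma texp_unipotent X : X ^+ N = 0 -> (texp N X - 1) ^+ N = 0.
Proof.
case: N N_gt1 => // N' _ X0.
rewrite /texp big_ord_recl /= invr1 scale1r addrC addKr.
pose q : 'M[F]_n := \sum_(i < N') (lift ord0 i)`!%:R^-1 *: X ^+ i.
have -> : \sum_(i < N') (bump 0 i)`!%:R^-1 *: X ^+ bump 0 i = X * q.
  rewrite mulr_sumr; apply: eq_bigr => i _.
  by rewrite -mx_scalerAr -exprS.
rewrite exprMn_comm; first by rewrite X0 mul0r.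
rewrite /GRing.comm mulr_sumr mulr_suml; apply: eq_bigr => i _.
by rewrite -mx_scalerAr -mx_scalerAl -exprS -exprSr.
Qed.

(** The curves s |-> exp (s X) and s |-> (exp X) ^ s are polynomial and agree at the
natural numbers, so they coincide; compare their velocities at s = 0. *)
Lemma texpK X : X ^+ N = 0 -> tlog N (texp N X) = X.
Proof.
move=> X0; rewrite -power_flow_velocity.
have -> : power_flow N (texp N X) = exp_flow N X.
  apply/matrixP => i j; apply: poly_eq_nat => m.
  have := power_flow_nat m (texp_unipotent X0).
  rewrite -texp_nat // -exp_flowE => /matrixP/(_ i j).
  by rewrite [LHS]mxE [in RHS]mxE.
by rewrite exp_flow_velocity // scale0r texp0 mul1r.
Qed.

End ExpLogInverse.

(** * Exponential and logarithm between G and its Lie algebra *)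

Lemma poly_eq0_derivn (F : numFieldType) (q : {poly F}) :
  (forall k, q^`(k).[0] = 0) -> q = 0.
Proof.
move=> q0; apply/polyP => k; rewrite coef0; apply/eqP.
have /eqP := q0 k; rewrite horner_coef0 coef_derivn addn0 mulrn_eq0.
by rewrite ffactnn -leqn0 leqNgt fact_gt0.
Qed.

Section AlgebraicGroupExp.
Variables (R : realType) (n N : nat).
Local Notation C := (Cplx R).
Implicit Types (X P : 'M[C]_n) (G : set 'M[C]_n).
Hypothesis N_gt1 : (1 < N)%N.

Lemma mx_exp_nilpotent X : X ^+ N = 0 -> mx_exp X = texp N X.
Proof.
move=> X0; apply/matrixP => i j; rewrite mxE.
apply: lim_near_cst; first exact: norm_hausdorff.
near=> M.
rewrite big_mkord (@sum_ord_trunc _ (fun k => (X ^+ k) i j / k`!%:R) N).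
- by rewrite summxE; apply: eq_bigr => k _; rewrite mxE mulrC.
- near: M; exact: nbhs_infty_ge.
- by move=> k Nk; rewrite (nilp_ge X0 Nk) mxE mul0r.
Unshelve. all: by end_near. Qed.

(** For f in the ideal of G, the derivatives at s = 0 of s |-> f (exp (s X)) are the
values at 1 of polynomials obtained from f by iterating the left-invariant
derivation of X; these are again in the ideal, so they vanish.  A polynomial
in s all of whose derivatives vanish at 0 is zero. *)
Lemma texp_in_group G X : algebraic_group G -> lie_algebra G X ->
  X ^+ N = 0 -> G (texp N X).
Proof.
move=> algG LX X0.
suff key p : vanishes_on G p -> forall q : {poly C},
    (forall s, q.[s] = peval p (mx_coords (texp N (s *: X)))) -> q = 0.
  have [[S GE] _ _ _] := algG.
  have GP A : G A <-> A \in unitmx /\ forall p, S p -> peval p (mx_coords A) = 0.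
    by rewrite GE.
  apply/GP; split.
    have := texpNr N_gt1 X0.
    by rewrite -mulmxE => /mulmx1_unit[uX _]; exact: uX.
  move=> p Sp.
  have vp : vanishes_on G p by move=> A /GP[_]; apply.
  have [q Hq] := curve_chain_rule p (exp_flow N X).
  have Eq s : q.[s] = peval p (mx_coords (texp N (s *: X))).
    by rewrite (Hq s).1 /curve exp_flowE.
  by have := Eq 1; rewrite (key p vp q Eq) horner0 scale1r.
move=> vp q Eq; apply: poly_eq0_derivn => k.
elim: k p q vp Eq => [|k IH] p q vp Eq.
  rewrite derivn0 Eq scale0r texp0 //; apply: vp; by case: algG.
have [p' vp' Hp'] := vanishes_on_left_derivative algG LX vp.
rewrite derivSn; apply: (IH p') => // s.
have [q' Hq'] := curve_chain_rule p (exp_flow N X).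
have -> : q = q'.
  apply: poly_eq_nat => m; rewrite Eq (Hq' _).1 /curve exp_flowE //.
by rewrite (Hq' s).2 Hp' /curve /velocity exp_flow_velocity // exp_flowE.
Qed.

(** For f in the ideal of G, the polynomial function s |-> f (P ^ s) vanishes at all
natural numbers because the powers of P are in G; hence it is zero, and so is
its derivative at s = 0. *)
Lemma tlog_in_lie_algebra G P : algebraic_group G -> G P ->
  (P - 1) ^+ N = 0 -> lie_algebra G (tlog N P).
Proof.
move=> [_ G1 GM _] GP P0; apply/lie_algebraE => p vp.
have [q Hq] := curve_chain_rule p (power_flow N P).
have GPm m : G (P ^+ m).
  by elim: m => [|m IH]; [exact: G1|rewrite exprS; exact: GM].
have q0 : q = 0.
  apply: poly_eq_nat => m.
  by rewrite (Hq _).1 /curve power_flow_nat // horner0; apply: vp.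
have := (Hq 0).2.
rewrite q0 deriv0 horner0 /curve /velocity power_flow_velocity => ->.
by have := power_flow_nat 0 P0; rewrite expr0 mulr0n => ->.
Qed.

End AlgebraicGroupExp.

(** * Matrices of a given weight *)

Section Weights.
Variables (R : realType) (n : nat) (T : set 'M[Cplx R]_n).
Local Notation C := (Cplx R).
Local Notation ch := (T -> C).
Implicit Types (M N : 'M[C]_n) (chi psi : ch) (A B : set ch).
Hypothesis T_unit : forall t : T, val t \in unitmx.

Definition conjT (t : T) M := val t *m M *m invmx (val t).

Lemma conjTD t M N : conjT t (M + N) = conjT t M + conjT t N.
Proof. by rewrite /conjT mulmxDr mulmxDl. Qed.

Lemma conjTZ t a M : conjT t (a *: M) = a *: conjT t M.
Proof. by rewrite /conjT -scalemxAr -scalemxAl. Qed.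

Lemma conjTM t M N : conjT t (M * N) = conjT t M * conjT t N.
Proof.
by rewrite /conjT -!mulmxE !mulmxA mulmxKV.
Qed.

Lemma conjT1 t : conjT t 1 = 1.
Proof. by rewrite /conjT mulmx1 mulmxV. Qed.

Definition weight chi M := forall t : T, conjT t M = chi t *: M.

Lemma weightD chi M N : weight chi M -> weight chi N -> weight chi (M + N).
Proof. by move=> wM wN t; rewrite conjTD wM wN scalerDr. Qed.

Lemma weightZ chi a M : weight chi M -> weight chi (a *: M).
Proof. by move=> wM t; rewrite conjTZ wM !scalerA mulrC. Qed.

Lemma weight0 chi : weight chi 0.
Proof. by move=> t; rewrite /conjT mulmx0 mul0mx scaler0. Qed.

Lemma weight1 : weight (fun=> 1) 1.
Proof. by move=> t; rewrite conjT1 scale1r. Qed.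

Lemma weightM chi psi M N :
  weight chi M -> weight psi N -> weight (chi \* psi) (M * N).
Proof.
move=> wM wN t.
by rewrite conjTM wM wN -mx_scalerAl -mx_scalerAr scalerA.
Qed.

Lemma weight_sum (K : finType) (Q : pred K) (M : K -> 'M[C]_n) chi :
  (forall k, Q k -> weight chi (M k)) -> weight chi (\sum_(k | Q k) M k).
Proof.
move=> wM; apply: (big_ind (weight chi)) => //; first exact: weight0.
exact: weightD.
Qed.

(** Inductive rather than a sum over a list: the statements about it are proved by
adding one weight vector at a time. *)
Inductive weight_span A : 'M[C]_n -> Prop :=
| weight_span0 : weight_span A 0
| weight_spanS chi M N : A chi -> weight chi M -> weight_span A N ->
    weight_span A (M + N).

Lemma weight_span1 A chi M : A chi -> weight chi M -> weight_span A M.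
Proof.
by move=> Achi wM; rewrite -[M]addr0; apply: weight_spanS wM _ => //; constructor.
Qed.

Lemma weight_spanD A M N :
  weight_span A M -> weight_span A N -> weight_span A (M + N).
Proof.
move=> sM sN; elim: sM => [|chi M1 M2 Achi wM1 _ IH]; first by rewrite add0r.
by rewrite -addrA; apply: weight_spanS wM1 IH.
Qed.

Lemma weight_spanZ A a M : weight_span A M -> weight_span A (a *: M).
Proof.
elim=> [|chi M1 M2 Achi wM1 _ IH]; first by rewrite scaler0; constructor.
by rewrite scalerDr; apply: weight_spanS (weightZ a wM1) IH.
Qed.

Lemma weight_spanW A B M : A `<=` B -> weight_span A M -> weight_span B M.
Proof.
move=> AB; elim=> [|chi M1 M2 Achi wM1 _ IH]; first by constructor.
by apply: weight_spanS wM1 IH; apply: AB.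
Qed.

Lemma weight_span_sum A (K : finType) (Q : pred K) (M : K -> 'M[C]_n) :
  (forall k, Q k -> weight_span A (M k)) ->
  weight_span A (\sum_(k | Q k) M k).
Proof.
move=> sM; apply: (big_ind (weight_span A)) => //; first by constructor.
exact: weight_spanD.
Qed.

Lemma weight_spanM A B A' M N :
  (forall chi psi, A chi -> B psi -> A' (chi \* psi)) ->
  weight_span A M -> weight_span B N -> weight_span A' (M * N).
Proof.
move=> AB sM sN; elim: sM => [|chi M1 M2 Achi wM1 _ IH].
  by rewrite mul0r; constructor.
rewrite mulrDl; apply: weight_spanD => //.
elim: sN => [|psi N1 N2 Bpsi wN1 _ IH']; first by rewrite mulr0; constructor.
by rewrite mulrDr; apply: weight_spanS (weightM wM1 wN1) IH'; apply: AB.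
Qed.

Definition stable_subspace (W : set 'M[C]_n) :=
  [/\ W 0, forall M N, W M -> W N -> W (M + N),
      forall a M, W M -> W (a *: M) & forall t M, W M -> W (conjT t M)].

(** Peel off the terms of N one at a time.  A term N1 of weight psi is absorbed into
the larger stable subspace of the Z with Z + a N1 in W for some a; this gives
M + a N1 in W, and then N1 is killed by conjugating with some t that separates
psi from chi and subtracting psi t times the same matrix. *)
Lemma weight_component W chi M N : stable_subspace W -> weight chi M ->
  weight_span [set psi | psi <> chi] N -> W (M + N) -> W M.
Proof.
move=> stW wM sN; elim: sN W stW => [|psi N1 N2 npsi wN1 _ IH] W stW.
  by rewrite addr0.
have [W0 WD WZ WT] := stW.
pose W' : set 'M[C]_n := [set Z | exists a, W (Z + a *: N1)].
have stW' : stable_subspace W'.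
  split; first by exists 0; rewrite scale0r addr0.
  - move=> Z Z' [a Wa] [b Wb]; exists (a + b).
    by rewrite scalerDl addrACA; apply: WD.
  - move=> a Z [b Wb]; exists (a * b).
    by rewrite -scalerA -scalerDr; apply: WZ.
  - move=> t Z [b Wb]; exists (b * psi t).
    by rewrite -scalerA -wN1 -conjTZ -conjTD; apply: WT.
move=> WMN; have [a Wa] : W' M.
  apply: (IH W' stW'); exists 1; rewrite scale1r -addrA [N2 + N1]addrC //.
have [t tne] : exists t, psi t <> chi t.
  apply: contrapT => /forallNP eqt; apply: npsi; apply/funext => t.
  by apply: contrapT => /eqt.
have ne0 : chi t - psi t != 0 by rewrite subr_eq0; apply/eqP => e; apply: tne.
have E : conjT t (M + a *: N1) + (- psi t) *: (M + a *: N1) =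
    (chi t - psi t) *: M.
  rewrite conjTD conjTZ wM wN1 scalerDr addrACA -scalerDl !scalerA -scalerDl.
  by rewrite mulNr [psi t * a]mulrC subrr scale0r addr0.
rewrite -[M](scalerK ne0) -E; apply: (WZ); apply: (WD); first exact: WT.
exact: WZ.
Qed.

Lemma weight_independent chi M N : weight chi M ->
  weight_span [set psi | psi <> chi] N -> M + N = 0 -> M = 0.
Proof.
move=> wM sN MN0; have := @weight_component [set 0] chi M N; apply=> //.
split=> //.
- by move=> ? ? -> ->; rewrite /= addr0.
- by move=> a ? ->; rewrite /= scaler0.
- by move=> t ? ->; rewrite /= (weight0 (fun=> 0)) scaler0.
Qed.

Lemma stable_lie_algebra (G : set 'M[C]_n) : algebraic_group G -> T `<=` G ->
  stable_subspace (lie_algebra G).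
Proof.
move=> algG TG; split; first exact: lie_algebra0.
- exact: lie_algebraD.
- by move=> a M; apply: lie_algebraZ.
- move=> t M; apply: lie_algebra_conj => //; apply: TG.
  by apply: set_mem; apply: valP.
Qed.

(** * Weight components of a finite family of matrices *)

Section Family.
Variables (K : finType) (M : K -> 'M[C]_n) (phi : K -> ch).
Hypothesis wM : forall k, weight (phi k) (M k).

Definition component chi := \sum_(k | `[< phi k = chi >]) M k.

Lemma component_weight chi : weight chi (component chi).
Proof. by apply: weight_sum => k /asboolP <-. Qed.

Lemma sum_other_span (Q : pred K) A :
  (forall k, Q k -> A (phi k)) -> weight_span A (\sum_(k | Q k) M k).
Proof.
by move=> QA; apply: weight_span_sum => k Qk; apply: weight_span1 (QA k Qk) _.
Qed.

Lemma component_eq0 chi : \sum_k M k = 0 -> component chi = 0.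
Proof.
rewrite (bigID (fun k => `[< phi k = chi >])) /=; apply: weight_independent.
  exact: component_weight.
by apply: sum_other_span => k /asboolP.
Qed.

(** The hypothesis on Q says that Q is a union of fibres of phi, so that the sum over
Q is a sum of full components. *)
Lemma sum_components_eq0 (Q : pred K) :
  (forall k k', phi k = phi k' -> Q k = Q k') ->
  (forall k, Q k -> component (phi k) = 0) -> \sum_(k | Q k) M k = 0.
Proof.
move=> Qphi Q0.
(* A canonical representative of the fibre of phi through k. *)
pose rep k := odflt k [pick k' | `[< phi k' = phi k >]].
have repP k : phi (rep k) = phi k.
  by rewrite /rep; case: pickP => //= k' /asboolP.
have rep_eq k k' : (rep k == rep k') = `[< phi k = phi k' >].
  apply/eqP/asboolP => [e|e]; first by rewrite -repP e repP.
  rewrite /rep e; case: pickP => //= /(_ k'); by rewrite asboolT.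
rewrite (partition_big rep xpredT) //= big1 // => k1 _.
case: (pickP (fun k => Q k && (rep k == k1))) => [k /andP[Qk /eqP <-]|none].
  rewrite -[RHS](Q0 k Qk); apply: eq_bigl => k'; rewrite rep_eq.
  apply: andb_idl => /asboolP e; by rewrite (Qphi _ _ e).
by rewrite big_pred0.
Qed.

End Family.

Lemma distinct_weights_bound m (p : 'I_m -> 'M[C]_n) (phi : 'I_m -> ch) :
  injective phi -> (forall i, weight (phi i) (p i)) -> (forall i, p i != 0) ->
  (m <= n * n)%N.
Proof.
move=> phi_inj wp p0; pose B := \matrix_(i < m) mxvec (p i).
suff /eqP <- : row_free B by apply: rank_leq_col.
apply/inj_row_free => v vB0.
have sum0 : \sum_i v 0 i *: p i = 0.
  apply: (can_inj mxvecK); rewrite linear_sum linear0 -[RHS]vB0 mulmx_sum_row.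
  by apply: eq_bigr => i _; rewrite linearZ rowK.
apply/rowP => i; rewrite mxE; apply/eqP.
have := @component_eq0 _ (fun i => v 0 i *: p i) phi _ (phi i) sum0.
rewrite /component (big_pred1 i); last first.
  move=> j; apply/asboolP/eqP => [/phi_inj //|-> //].
move=> /(_ (fun i => weightZ _ (wp i)))/eqP.
by rewrite scaler_eq0 (negbTE (p0 i)) orbF.
Qed.

(** * Nilpotency of sums of matrices of positive weight *)

Variables (S : set ch) (l : ch -> R).
Hypotheses (S1 : S (fun=> 1))
  (SM : forall chi psi, S chi -> S psi -> S (chi \* psi))
  (lM : forall chi psi, S chi -> S psi -> l (chi \* psi) = l chi + l psi).

Lemma form1 : l (fun=> 1) = 0.
Proof.
have := lM S1 S1; rewrite (_ : _ \* _ = (fun=> 1)).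
  by move/eqP; rewrite -subr_eq0 opprD addNKr oppr_eq0 => /eqP.
by apply/funext => t /=; rewrite mulr1.
Qed.

(** The partial products have strictly increasing values of l, hence distinct
weights; if the whole product is nonzero they are m + 1 > n * n nonzero matrices
of size n, which are linearly independent. *)
Lemma long_word_eq0 m (f : 'I_m -> 'M[C]_n) (phi : 'I_m -> ch) :
  (n * n <= m)%N -> (forall i, weight (phi i) (f i)) ->
  (forall i, S (phi i)) -> (forall i, 0 < l (phi i)) -> \prod_i f i = 0.
Proof.
move=> nm wf Sphi phi0; apply: contrapT => /eqP prod0.
(* Extend the word by arbitrary letters, so that its prefixes have indices in nat. *)
pose F a := if insub a is Some i then f i else 0.
pose Phi a := if insub a is Some i then phi i else fun=> 1.
pose P a : 'M[C]_n := \prod_(i < a) F i.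
pose X a : ch := fun t => \prod_(i < a) Phi i t.
have XS a : X a.+1 = X a \* Phi a.
  by apply/funext => t; rewrite /X big_ord_recr.
have SPhi a : S (Phi a) by rewrite /Phi; case: insubP.
have SX a : S (X a).
  elim: a => [|a IH]; last by rewrite XS; apply: SM.
  by rewrite (_ : X 0 = fun=> 1) //; apply/funext => t; rewrite /X big_ord0.
have wP a : (a <= m)%N -> weight (X a) (P a).
  elim: a => [|a IH] am.
    rewrite (_ : X 0 = fun=> 1); last by apply/funext => t; rewrite /X big_ord0.
    by rewrite /P big_ord0; apply: weight1.
  rewrite XS /P big_ord_recr /=; apply: weightM; first exact/IH/ltnW.
  by rewrite /Phi /F (insubT (fun a => a < m)%N am).
have P0 a : (a <= m)%N -> P a != 0.
  move=> am; apply: contraNneq prod0 => Pa0.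
  have -> : \prod_i f i = P m.
    apply: eq_bigr => i _; rewrite /F (insubT (fun a => a < m)%N (ltn_ord i)).
    by congr f; apply: val_inj.
  rewrite /P -(big_mkord xpredT F) (big_cat_nat (n := a)) //= big_mkord.
  by rewrite -/(P a) Pa0 mul0r.
have lX a b : (a < b)%N -> (b <= m)%N -> l (X a) < l (X b).
  elim: b => // b IH; rewrite ltnS leq_eqVlt => ab bm.
  rewrite XS lM // /Phi (insubT (fun a => a < m)%N bm).
  case/predU1P: ab => [->|ab]; first by rewrite ltrDl phi0.
  by apply: lt_trans (IH ab (ltnW bm)) _; rewrite ltrDl phi0.
suff : (m.+1 <= n * n)%N by rewrite ltnNge nm.
apply: (@distinct_weights_bound m.+1 (fun i => P i) (fun i => X i)).
- move=> i j eX; apply: val_inj => /=.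
  have im := ltn_ord i; have jm := ltn_ord j; rewrite !ltnS in im jm.
  case: (ltngtP i j) => // ij.
    by have := lX _ _ ij jm; rewrite eX ltxx.
  by have := lX _ _ ij im; rewrite eX ltxx.
- by move=> i; apply: wP; rewrite -ltnS.
- by move=> i; apply: P0; rewrite -ltnS.
Qed.

Lemma positive_sum_nilpotent (K : finType) (Q : pred K) (M : K -> 'M[C]_n)
    (phi : K -> ch) m : (n * n <= m)%N ->
  (forall k, Q k -> [/\ weight (phi k) (M k), S (phi k) & 0 < l (phi k)]) ->
  (\sum_(k | Q k) M k) ^+ m = 0.
Proof.
move=> nm H; rewrite -[in LHS](card_ord m) -prodr_const.
rewrite bigA_distr_big /= big1 // => f /ffun_onP fQ.
apply: (long_word_eq0 (phi := fun i => phi (f i)) nm) => i;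
  by have [] := H _ (fQ i).
Qed.

End Weights.

(** * Products of finite sums *)

(** The ring need not be commutative, so the factors are listed in the order of s
rather than in the enumeration order of I. *)
Lemma prod_seq_distr (A : pzSemiRingType) (I J : finType) (s : seq I)
    (F : I -> J -> A) : uniq s -> (forall i, i \in s) ->
  \prod_(i <- s) \sum_j F i j =
  \sum_(k : {ffun I -> J}) \prod_(i <- s) F i (k i).
Proof.
move=> us sI; pose t := in_tuple s.
rewrite (big_tnth _ _ s) bigA_distr_bigA /=.
have idx i : (index i s < size s)%N by rewrite index_mem.
have tK (a : 'I_(size s)) : Ordinal (idx (tnth t a)) = a.
  by apply: val_inj; rewrite /= (tnth_nth (tnth t a)) /= index_uniq.
have iK i : tnth t (Ordinal (idx i)) = i.
  by rewrite (tnth_nth i) /= nth_index.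
pose h (k : {ffun I -> J}) := [ffun a : 'I_(size s) => k (tnth t a)].
pose g (f : {ffun 'I_(size s) -> J}) := [ffun i => f (Ordinal (idx i))].
rewrite (reindex h) /=.
  apply: eq_bigr => k _; rewrite [RHS]big_tnth.
  by apply: eq_bigr => a _; rewrite ffunE.
exists g => [k|f] _; apply/ffunP => x; rewrite !ffunE.
  by rewrite iK.
by rewrite tK.
Qed.

(** * Fixpoints of triangular maps *)

Section Triangular.
Variables (R : realDomainType) (J : finType) (V : Type) (d : J -> R).
Variable Phi : (J -> V) -> J -> V.
Hypothesis Phi_tri : forall X X' j,
  (forall i, d i < d j -> X i = X' i) -> Phi X j = Phi X' j.

Let rank j := #|[pred i | d i < d j]|.

Let rank_lt i j : d i < d j -> (rank i < rank j)%N.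
Proof.
move=> ij; apply: proper_card; apply/fintype.properP; split.
  by apply/fintype.subsetP => k; rewrite !inE => /lt_trans; apply.
by exists i; rewrite !inE ?ltxx.
Qed.

Lemma triangular_ind (P : J -> Prop) :
  (forall j, (forall i, d i < d j -> P i) -> P j) -> forall j, P j.
Proof.
move=> IH j; have [m] := ubnP (rank j); elim: m j => // m IHm j rj.
by apply: IH => i /rank_lt ij; apply: IHm; apply: leq_trans ij _.
Qed.

Lemma triangular_fixpoint_unique X X' :
  Phi X =1 X -> Phi X' =1 X' -> X =1 X'.
Proof.
move=> fX fX'; elim/triangular_ind => j IH.
by rewrite -fX -fX'; apply: Phi_tri.
Qed.

(** After m steps the coordinates of rank below m no longer change, and all ranks are
below #|J|. *)
Lemma triangular_fixpoint X0 :
  Phi (iter #|J| Phi X0) =1 iter #|J| Phi X0.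
Proof.
suff stab m j : (rank j < m)%N -> iter m.+1 Phi X0 j = iter m Phi X0 j.
  move=> j; apply: (stab #|J|); rewrite -(cardC (pred1 j)).
  rewrite card1 add1n ltnS; apply: subset_leq_card.
  apply/fintype.subsetP => i; rewrite !inE => ij.
  by apply: contraTneq ij => ->; rewrite ltxx.
elim: m j => // m IH j rj; rewrite -[LHS]/(Phi (iter m.+1 Phi X0) j).
rewrite -[RHS]/(Phi (iter m Phi X0) j).
apply: Phi_tri => i /rank_lt ij; apply: IH.
by apply: leq_trans ij _.
Qed.

End Triangular.

(** * The leading component of an element of G *)

Section Scattering.
Variables (R : realType) (n : nat) (G T : set 'M[Cplx R]_n).
Local Notation C := (Cplx R).
Local Notation ch := (T -> C).
(* Products of n * n matrices of positive weight vanish, so exponentials may be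
   truncated at N; the truncation must keep the exponent 1. *)
Local Notation N := (n * n).+2.
Implicit Types (chi psi : ch).
Hypotheses (algG : algebraic_group G) (TG : T `<=` G)
  (T_unit : forall t : T, val t \in unitmx).
Variables (S : set ch) (l : ch -> R).
Hypotheses (S1 : S (fun=> 1))
  (SM : forall chi psi, S chi -> S psi -> S (chi \* psi))
  (lM : forall chi psi, S chi -> S psi -> l (chi \* psi) = l chi + l psi).

Let N_ge : (n * n <= N)%N. Proof. by rewrite -addn2 leq_addr. Qed.

Lemma positive_weight_nilpotent chi X : S chi -> 0 < l chi -> weight chi X ->
  X ^+ N = 0.
Proof.
move=> Schi chi0 wX.
have := @positive_sum_nilpotent _ _ _ T_unit _ _ S1 SM lM unit xpredT
  (fun=> X) (fun=> chi) N N_ge.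
by rewrite (big_pred1 tt) => [|[]//]; apply.
Qed.

Section Leading.
Variables (K : finType) (k0 : K) (M : K -> 'M[C]_n) (phi : K -> ch).
(* The monomials of a product of exponentials, with k0 the zero exponent. *)
Hypotheses (M0 : M k0 = 1) (phi0 : phi k0 = (fun=> 1))
  (wM : forall k, weight (phi k) (M k)) (Sphi : forall k, S (phi k))
  (phi_pos : forall k, k != k0 -> 0 < l (phi k)).
Hypothesis GM : G (\sum_k M k).

(** Below l chi, the matrix P = sum_k M k has no component other than 1.  Then the
powers of P - 1 from the square on have weights of l at least 2 l chi, so P - 1
and log P have the same component along chi; and log P is in the Lie algebra of G. *)
Lemma leading_component_in_lie chi : 0 < l chi ->
  \sum_(k | (k != k0) && (l (phi k) < l chi)) M k = 0 ->
  lie_algebra G (component M phi chi).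
Proof.
move=> chi0 low0; pose Z := \sum_(k | k != k0) M k.
pose gr c : set ch := [set psi | S psi /\ c <= l psi].
have PE : \sum_k M k = 1 + Z by rewrite (bigD1 k0) //= M0.
have ZE : Z = \sum_(k | (k != k0) && (l chi <= l (phi k))) M k.
  rewrite /Z (bigID (fun k => l (phi k) < l chi)) /= low0 add0r.
  by apply: eq_bigl => k; rewrite -leNgt.
have compE : Z = component M phi chi +
    \sum_(k | (k != k0) && (l chi <= l (phi k)) && ~~ `[< phi k = chi >]) M k.
  rewrite ZE (bigID (fun k => `[< phi k = chi >])) /=; congr (_ + _).
  apply: eq_bigl => k; apply: andb_idl => /asboolP e; rewrite e lexx andbT.
  by apply: contraTneq chi0 => k_k0; rewrite -e k_k0 phi0 (form1 S1 lM) ltxx.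
have sZ : weight_span (gr (l chi)) Z.
  by rewrite ZE; apply: sum_other_span => // k /andP[_ lk]; split.
have sZn m : weight_span (gr (l chi + l chi)) (Z ^+ m.+2).
  have : weight_span (gr (l chi)) (Z ^+ m.+1).
    elim: m => [|m IH]; first by rewrite expr1.
    rewrite exprS; apply: weight_spanM sZ IH => // psi psi' [Sp lp] [Sp' lp'].
    split; first exact: SM.
    by rewrite lM //; apply: le_trans lp _; rewrite lerDl (le_trans (ltW chi0)).
  move=> sm; rewrite exprS.
  apply: weight_spanM sZ sm => // psi psi' [Sp lp] [Sp' lp'].
  by split; [exact: SM|rewrite lM // lerD].
have Z0 : Z ^+ N = 0.
  apply: (positive_sum_nilpotent T_unit S1 SM lM (phi := phi) N_ge) => k kk0.
  by split; auto.
have := tlog_in_lie_algebra algG GM (N := N).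
rewrite {1}PE [1 + Z]addrC addrK => /(_ Z0).
rewrite /tlog PE [1 + Z]addrC addrK big_ord_recl big_ord_recl /=.
(* The terms of degree 0 and 1 of the logarithm are 0 and P - 1. *)
rewrite binomial_poly0 binomial_poly1 -polyC1 derivC horner0 scale0r add0r.
rewrite derivX hornerC scale1r expr1 {1}compE -addrA.
apply: (weight_component (chi := chi)).
- exact: stable_lie_algebra.
- exact: component_weight.
apply: weight_spanD.
  by apply: sum_other_span => // k /andP[_ /asboolP].
apply: weight_span_sum => k _; apply: weight_spanZ.
apply: weight_spanW (sZn _) => psi [_ lpsi] /= e.
by move: lpsi; rewrite e gerDl leNgt chi0.
Qed.

(** If all the components below a given value of l vanish, those at that value are in
the Lie algebra of G, where the hypothesis forces them to vanish: conclude by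
induction on l. *)
Lemma low_components_eq0 c :
  (forall chi, S chi -> 0 < l chi -> l chi < c ->
     lie_algebra G (component M phi chi) -> component M phi chi = 0) ->
  \sum_(k | (k != k0) && (l (phi k) < c)) M k = 0.
Proof.
move=> H.
have k0P k : (k != k0) = (0 < l (phi k)).
  apply/idP/idP; first exact: phi_pos.
  by apply: contraTneq => ->; rewrite phi0 (form1 S1 lM) ltxx.
have sat c' k k' : phi k = phi k' ->
    (k != k0) && (l (phi k) < c') = (k' != k0) && (l (phi k') < c').
  by move=> e; rewrite !k0P e.
apply: (sum_components_eq0 (Q := fun k => (k != k0) && (l (phi k) < c))).
  exact: sat.
elim/(triangular_ind (d := fun k => l (phi k))) => k IH /andP[kk0 lk].
apply: H => //; first exact: phi_pos.
apply: leading_component_in_lie; first exact: phi_pos.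
apply: (sum_components_eq0
  (Q := fun k' => (k' != k0) && (l (phi k') < l (phi k)))).
  exact: sat.
move=> k' /andP[k'k0 lk'].
by apply: IH => //; rewrite k'k0 (lt_trans lk' lk).
Qed.

End Leading.

(** * Expanding the product of exponentials *)

Variables (I J : finType) (rays : seq (I + J)) (lab : I + J -> ch).
Hypotheses (rays_uniq : uniq rays) (rays_all : forall r, r \in rays)
  (lab_out_inj : injective (fun j => lab (inr j)))
  (Slab : forall r, S (lab r)) (lab_pos : forall r, 0 < l (lab r)).
Implicit Types (r : I + J) (Y : I + J -> 'M[C]_n).

Definition exponent := {ffun I + J -> 'I_N}.
Implicit Types (k : exponent).

Definition monomial Y k : 'M[C]_n :=
  \prod_(r <- rays) ((k r)`!%:R^-1 *: Y r ^+ k r).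

Definition monomial_char k : ch := fun t => \prod_(r <- rays) lab r t ^+ k r.

Definition dirac_exponent r : exponent := [ffun r' => inord (r' == r)].
Definition zero_exponent : exponent := [ffun _ => inord 0].

Lemma texp_prodE Y :
  \prod_(r <- rays) texp N (Y r) = \sum_k monomial Y k.
Proof. exact: prod_seq_distr. Qed.

Lemma dirac_exponentE r r' : dirac_exponent r r' = (r' == r) :> nat.
Proof. by rewrite ffunE inordK // ltnS (leq_trans (leq_b1 _)). Qed.

Lemma zero_exponentE r : zero_exponent r = 0%N :> nat.
Proof. by rewrite ffunE inordK. Qed.

Lemma big_rays_pred1 (A : Type) (idx : A) (op : Monoid.law idx)
    (F : I + J -> A) r :
  \big[op/idx]_(r' <- rays) (if r' == r then F r' else idx) = F r.
Proof. rewrite -big_mkcond -big_filter (@filter_pred1_uniq _ rays r) //.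
by rewrite big_seq1. Qed.

Lemma monomial_dirac Y r : monomial Y (dirac_exponent r) = Y r.
Proof.
rewrite /monomial -[RHS](big_rays_pred1 (@GRing.mul 'M[C]_n)).
apply: eq_bigr => r' _; rewrite dirac_exponentE.
by case: eqP => _; rewrite ?expr1 ?expr0 invr1 scale1r.
Qed.

Lemma monomial_char_dirac r : monomial_char (dirac_exponent r) = lab r.
Proof.
apply/funext => t; rewrite /monomial_char.
rewrite -[RHS](big_rays_pred1 (@GRing.mul C) (fun r' => lab r' t)).
by apply: eq_bigr => r' _; rewrite dirac_exponentE; case: eqP.
Qed.

Lemma monomial_zero Y : monomial Y zero_exponent = 1.
Proof.
rewrite /monomial big1 // => r _.
by rewrite zero_exponentE expr0 invr1 scale1r.
Qed.

Lemma monomial_char_zero : monomial_char zero_exponent = (fun=> 1).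
Proof.
by apply/funext => t; rewrite /monomial_char big1 // => r _; rewrite zero_exponentE.
Qed.

Lemma charX chi (m : nat) : S chi ->
  S (fun t => chi t ^+ m) /\ l (fun t => chi t ^+ m) = m%:R * l chi.
Proof.
move=> Schi; elim: m => [|m [SIH lIH]].
  by rewrite (_ : (fun t => _) = fun=> 1) // (form1 S1 lM) mul0r.
have -> : (fun t => chi t ^+ m.+1) = chi \* (fun t => chi t ^+ m).
  by apply/funext => t; rewrite exprS.
split; first exact: SM.
by rewrite lM // lIH -natr1 mulrDl mul1r addrC.
Qed.

Lemma monomial_charP k : S (monomial_char k) /\
  l (monomial_char k) = \sum_r (k r)%:R * l (lab r).
Proof.
have -> : \sum_r (k r)%:R * l (lab r) = \sum_(r <- rays) (k r)%:R * l (lab r).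
  by rewrite [RHS]big_uniq //; apply: eq_bigl => r; rewrite rays_all.
rewrite /monomial_char; elim: (rays) => [|r s [SIH lIH]].
  rewrite big_nil (_ : (fun t => _) = fun=> 1) ?(form1 S1 lM) //.
  by apply/funext => t; rewrite big_nil.
have [SX lX] := charX (k r) (Slab r).
rewrite (_ : (fun t => _) = (fun t => lab r t ^+ k r) \*
   (fun t => \prod_(r <- s) lab r t ^+ k r)); last first.
  by apply/funext => t; rewrite big_cons.
by split; [exact: SM|rewrite lM // lX lIH big_cons].
Qed.

Lemma monomial_char_pos k : k != zero_exponent -> 0 < l (monomial_char k).
Proof.
move=> k0; rewrite (monomial_charP k).2.
have [r kr] : exists r, (k r != 0 :> nat).
  apply: contrapT => /forallNP kr; case/eqP: k0; apply/ffunP => r.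
  apply: val_inj; apply: contrapT => /eqP kr'; apply: (kr r).
  by move: kr'; rewrite /= zero_exponentE.
rewrite (bigD1 r) //=; apply: ltr_wpDr.
  by apply: sumr_ge0 => r' _; rewrite mulr_ge0 // ltW.
by rewrite mulr_gt0 // ltr0n lt0n.
Qed.

Lemma monomial_weight Y k : (forall r, weight (lab r) (Y r)) ->
  weight (monomial_char k) (monomial Y k).
Proof.
move=> wY; rewrite /monomial_char /monomial; elim: (rays) => [|r s IH].
  rewrite big_nil (_ : (fun t => _) = fun=> 1); first exact: weight1.
  by apply/funext => t; rewrite big_nil.
rewrite (_ : (fun t => _) = (fun t => lab r t ^+ k r) \*
   (fun t => \prod_(r <- s) lab r t ^+ k r)); last first.
  by apply/funext => t; rewrite big_cons.
rewrite big_cons; apply: weightM => //; apply: weightZ.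
elim: (nat_of_ord (k r)) => [|m IHm].
  rewrite expr0 (_ : (fun t => _) = fun=> 1) //; exact: weight1.
rewrite exprS (_ : (fun t => _) = lab r \* (fun t => lab r t ^+ m)).
  exact: weightM.
by apply/funext => t; rewrite exprS.
Qed.

(** The values of l on the labels are positive and add up, with multiplicities, to
the value at j.  A label of the same value as j can then only occur alone and once,
that is, as the monomial X_j itself. *)
Lemma monomial_char_lower k j i : monomial_char k = lab (inr j) ->
  k != dirac_exponent (inr j) -> (k (inr i) != 0 :> nat) ->
  l (lab (inr i)) < l (lab (inr j)).
Proof.
move=> kj knj ki; rewrite -kj (monomial_charP k).2 (bigD1 (inr i)) //=.
set rest := \sum_(r | _) _.
have rest0 : 0 <= rest.
  by apply: sumr_ge0 => r _; rewrite mulr_ge0 // ltW.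
have ki1 : l (lab (inr i)) <= (k (inr i))%:R * l (lab (inr i)).
  by rewrite ler_peMl ?(ltW (lab_pos _)) // ler1n lt0n.
rewrite lt_neqAle (le_trans ki1) ?lerDl // andbT.
apply: contra_neq knj => e.
have /eqP rest_eq0 : rest == 0.
  rewrite eq_le rest0 andbT -(lerD2l ((k (inr i))%:R * l (lab (inr i)))).
  by rewrite addr0 -e.
have ki_eq1 : k (inr i) = 1%N :> nat.
  move: e; rewrite rest_eq0 addr0 -{1}[l _]mul1r.
  by move/(mulIf (lt0r_neq0 (lab_pos _)))/eqP; rewrite eq_sym pnatr_eq1 => /eqP.
have kE : k = dirac_exponent (inr i).
  apply/ffunP => r; apply: val_inj.
  rewrite -[RHS]/(nat_of_ord _) dirac_exponentE.
  case: eqP => [-> //|/eqP ri]; apply/eqP.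
  have /eqP := rest_eq0; rewrite psumr_eq0; last first.
    by move=> r' _; rewrite mulr_ge0 // ltW.
  move=> /allP/(_ r (mem_index_enum _))/implyP/(_ ri).
  by rewrite mulf_eq0 (gt_eqF (lab_pos r)) orbF pnatr_eq0.
by move: kj; rewrite kE monomial_char_dirac => /lab_out_inj ->.
Qed.

Definition lower_terms Y j : 'M[C]_n :=
  \sum_(k | `[< monomial_char k = lab (inr j) >] &&
            (k != dirac_exponent (inr j))) monomial Y k.

Lemma component_labE Y j :
  component (monomial Y) monomial_char (lab (inr j)) =
  Y (inr j) + lower_terms Y j.
Proof.
rewrite /component (bigD1 (dirac_exponent (inr j))) ?monomial_dirac //=.
by apply/asboolP; rewrite monomial_char_dirac.
Qed.

Lemma eq_lower_terms Y Y' j : (forall i, Y (inl i) = Y' (inl i)) ->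
  (forall i, l (lab (inr i)) < l (lab (inr j)) -> Y (inr i) = Y' (inr i)) ->
  lower_terms Y j = lower_terms Y' j.
Proof.
move=> Yl Yr; apply: eq_bigr => k /andP[/asboolP kj knj].
apply: eq_bigr => -[i|i] _; first by rewrite Yl.
have [->//|ki] := eqVneq (nat_of_ord (k (inr i))) 0%N.
by rewrite Yr //; apply: monomial_char_lower kj knj ki.
Qed.

(** * The triangular system of the outgoing logarithms *)

Definition ray_logs (Xin : I -> 'M[C]_n) (X : J -> 'M[C]_n) r : 'M[C]_n :=
  match r with inl i => - Xin i | inr j => X j end.

Definition scattering_step Xin X j : 'M[C]_n := - lower_terms (ray_logs Xin X) j.

(** The solution of the triangular system, reached after as many steps as there are
unknowns. *)
Definition scattered_logs Xin : J -> 'M[C]_n :=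
  iter #|J| (scattering_step Xin) (fun=> 0).

Lemma scattering_step_triangular Xin X X' j :
  (forall i, l (lab (inr i)) < l (lab (inr j)) -> X i = X' i) ->
  scattering_step Xin X j = scattering_step Xin X' j.
Proof.
move=> XX'; rewrite /scattering_step.
suff -> : lower_terms (ray_logs Xin X) j = lower_terms (ray_logs Xin X') j by [].
by apply: eq_lower_terms => i //; apply: XX'.
Qed.

(** The identity has trivial weight, so its component along the label of j is zero. *)
Lemma product1_scattered Xin X :
  (forall r, weight (lab r) (ray_logs Xin X r)) ->
  \prod_(r <- rays) texp N (ray_logs Xin X r) = 1 ->
  X =1 scattered_logs Xin.
Proof.
move=> wY; rewrite texp_prodE => P1.
apply: (triangular_fixpoint_unique (@scattering_step_triangular Xin)); last first.
  exact: (triangular_fixpoint (@scattering_step_triangular Xin)).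
move=> j; suff : X j + lower_terms (ray_logs Xin X) j = 0.
  by move/eqP; rewrite addr_eq0 => /eqP ->.
rewrite -[X j]/(ray_logs Xin X (inr j)) -component_labE.
have wk k : weight (monomial_char k) (monomial (ray_logs Xin X) k).
  exact: monomial_weight.
apply: (weight_independent (N := \sum_(k | ~~ `[< monomial_char k = lab (inr j) >])
   monomial (ray_logs Xin X) k + -1)).
- exact: component_weight.
- apply: weight_spanD; first by apply: sum_other_span => // k /asboolP.
  rewrite -scaleN1r; apply: (weight_span1 (chi := fun=> 1)).
    move=> /= e; have := lab_pos (inr j).
    by rewrite -e (form1 S1 lM) ltxx.
  by apply: weightZ; apply: weight1.
rewrite addrA -(bigID (fun k => `[< monomial_char k = lab (inr j) >]) xpredT).
by rewrite P1 subrr.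
Qed.

(** * Solving the scattering equation *)

Hypothesis out_complete : forall chi X, S chi -> 0 < l chi ->
  lie_algebra G X -> weight chi X -> X != 0 -> exists j, chi = lab (inr j).

Lemma texp_prod_in_group Y :
  (forall r, lie_algebra G (Y r) /\ weight (lab r) (Y r)) ->
  G (\sum_k monomial Y k).
Proof.
move=> HY; rewrite -texp_prodE; have [_ G1 GM _] := algG.
apply: (big_ind G) => // r _; have [LY wY] := HY r.
apply: texp_in_group => //.
exact: positive_weight_nilpotent (Slab r) (lab_pos r) wY.
Qed.

(** A nonzero component in the Lie algebra of G makes its character the label of an
outgoing ray, and along those labels the components vanish by hypothesis. *)
Lemma lower_sum_eq0 Y c :
  (forall r, lie_algebra G (Y r) /\ weight (lab r) (Y r)) ->
  (forall j, l (lab (inr j)) < c -> Y (inr j) + lower_terms Y j = 0) ->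
  \sum_(k | (k != zero_exponent) && (l (monomial_char k) < c)) monomial Y k = 0.
Proof.
move=> HY Y0.
apply: (low_components_eq0 (monomial_zero Y) monomial_char_zero) => //.
- by move=> k; apply: monomial_weight => r; case: (HY r).
- by move=> k; case: (monomial_charP k).
- exact: monomial_char_pos.
- exact: texp_prod_in_group.
move=> chi Schi chi0 chic Lchi; apply: contrapT => /eqP ne0.
have [|j chij] := out_complete Schi chi0 Lchi _ ne0.
  by apply: component_weight => k; apply: monomial_weight => r; case: (HY r).
by case/eqP: ne0; rewrite chij component_labE Y0 // -chij.
Qed.

Lemma scattered_logs_eq Xin j :
  scattered_logs Xin j + lower_terms (ray_logs Xin (scattered_logs Xin)) j = 0.
Proof.
rewrite -[X in X + _](triangular_fixpoint (@scattering_step_triangular Xin)).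
by rewrite addNr.
Qed.

(** By induction on l.  Replace by 0 the unknowns from j on, in the order of l: the
product of exponentials thus obtained is in G by induction, its components along the
labels before j still vanish, and its component along the label of j is - X_j.
This is a leading component. *)
Lemma scattered_logs_in_root_space Xin :
  (forall i, lie_algebra G (Xin i) /\ weight (lab (inl i)) (Xin i)) ->
  forall j, lie_algebra G (scattered_logs Xin j) /\
            weight (lab (inr j)) (scattered_logs Xin j).
Proof.
move=> HX; elim/(triangular_ind (d := fun j => l (lab (inr j)))) => j IH.
set X := scattered_logs Xin in IH *.
pose Xlow i := if l (lab (inr i)) < l (lab (inr j)) then X i else 0.
pose Y := ray_logs Xin Xlow.
have HY r : lie_algebra G (Y r) /\ weight (lab r) (Y r).
  case: r => i; rewrite /Y /ray_logs /=.
    have [LX wX] := HX i; rewrite -scaleN1r.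
    by split; [apply: lie_algebraZ|apply: weightZ].
  rewrite /Xlow; case: ifP => [/IH //|_].
  by split; [apply: lie_algebra0|apply: weight0].
have lowE i : l (lab (inr i)) <= l (lab (inr j)) ->
    lower_terms Y i = lower_terms (ray_logs Xin X) i.
  move=> ij; apply: eq_lower_terms => // a ai.
  by rewrite /Y /ray_logs /Xlow (lt_le_trans ai ij).
have Y0 i : l (lab (inr i)) < l (lab (inr j)) -> Y (inr i) + lower_terms Y i = 0.
  by move=> ij; rewrite lowE ?(ltW ij) // /Y /ray_logs /Xlow ij scattered_logs_eq.
have wk k : weight (monomial_char k) (monomial Y k).
  by apply: monomial_weight => r; case: (HY r).
have XE : X j = (-1) *: component (monomial Y) monomial_char (lab (inr j)).
  rewrite component_labE lowE // scaleN1r /Y /ray_logs /Xlow ltxx add0r.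
  by apply/eqP; rewrite -addr_eq0 scattered_logs_eq.
rewrite XE; split; last by apply: weightZ; apply: component_weight.
apply: lie_algebraZ.
apply: (leading_component_in_lie (monomial_zero Y) monomial_char_zero) => //.
- by move=> k; case: (monomial_charP k).
- exact: monomial_char_pos.
- exact: texp_prod_in_group.
exact: lower_sum_eq0.
Qed.

Lemma scattered_product1 Xin :
  (forall i, lie_algebra G (Xin i) /\ weight (lab (inl i)) (Xin i)) ->
  \prod_(r <- rays) texp N (ray_logs Xin (scattered_logs Xin) r) = 1.
Proof.
move=> HX; set Y := ray_logs _ _.
have HY r : lie_algebra G (Y r) /\ weight (lab r) (Y r).
  case: r => i; last exact: scattered_logs_in_root_space.
  have [LX wX] := HX i; rewrite /Y /ray_logs -scaleN1r.
  by split; [apply: lie_algebraZ|apply: weightZ].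
rewrite texp_prodE (bigD1 zero_exponent) //= monomial_zero.
(* A bound for l on all the monomials, so that none of them is left out. *)
pose c := \sum_k `|l (monomial_char k)| + 1.
rewrite -[RHS]addr0; congr (_ + _).
rewrite -[RHS](@lower_sum_eq0 Y c HY); last first.
  by move=> j _; apply: scattered_logs_eq.
apply: eq_bigl => k; rewrite /c (bigD1 k) //=; case: (k != _) => //=.
rewrite (le_lt_trans (ler_norm _)) // -addrA ltrDl.
by apply: ltr_wpDl => //; apply: sumr_ge0.
Qed.

End Scattering.

(** * Polynomial functions *)

Section PolynomialFunctions.
Variables (R : realType) (K : finType) (U : Type) (c : U -> K -> Cplx R).
Local Notation C := (Cplx R).

Definition polynomial_fun (f : U -> C) :=
  exists p : mpolynomial R K, forall u, f u = peval p (c u).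

Lemma polynomial_fun_cst a : polynomial_fun (fun=> a).
Proof. by exists (mpolyC _ a) => u; rewrite pevalC. Qed.

Lemma polynomial_fun_coord k : polynomial_fun (fun u => c u k).
Proof.
by exists (mpolyX _ (mnm1 (enum_rank k))) => u; rewrite pevalX enum_rankK.
Qed.

Lemma polynomial_funD f g :
  polynomial_fun f -> polynomial_fun g -> polynomial_fun (fun u => f u + g u).
Proof.
by move=> [p fp] [q gq]; exists (p + q) => u; rewrite pevalD fp gq.
Qed.

Lemma polynomial_funM f g :
  polynomial_fun f -> polynomial_fun g -> polynomial_fun (fun u => f u * g u).
Proof.
by move=> [p fp] [q gq]; exists (p * q) => u; rewrite pevalM fp gq.
Qed.

Lemma polynomial_fun_sum (A : Type) (s : seq A) (P : pred A) (f : A -> U -> C) :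
  (forall a, polynomial_fun (f a)) ->
  polynomial_fun (fun u => \sum_(a <- s | P a) f a u).
Proof.
move=> pf; elim: s => [|a s [p IH]].
  by exists (mpolyC _ 0) => u; rewrite big_nil pevalC.
case: (boolP (P a)) => Pa; last first.
  by exists p => u; rewrite big_cons (negbTE Pa).
have [q fq] := pf a.
by exists (q + p) => u; rewrite big_cons Pa pevalD fq IH.
Qed.

Variable n : nat.
Implicit Types (F : U -> 'M[C]_n).

Definition polynomial_mx F := forall i j, polynomial_fun (fun u => F u i j).

Lemma polynomial_mx_ext F F' :
  F =1 F' -> polynomial_mx F -> polynomial_mx F'.
Proof. by move=> /funext ->. Qed.

Lemma polynomial_mx_cst A : polynomial_mx (fun=> A).
Proof. by move=> i j; apply: polynomial_fun_cst. Qed.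

Lemma polynomial_mxD F F' :
  polynomial_mx F -> polynomial_mx F' -> polynomial_mx (fun u => F u + F' u).
Proof.
move=> pF pF' i j; have [p Hp] := polynomial_funD (pF i j) (pF' i j).
by exists p => u; rewrite mxE.
Qed.

Lemma polynomial_mxZ a F :
  polynomial_mx F -> polynomial_mx (fun u => a *: F u).
Proof.
move=> pF i j.
have [p Hp] := polynomial_funM (polynomial_fun_cst a) (pF i j).
by exists p => u; rewrite mxE.
Qed.

Lemma polynomial_mxN F : polynomial_mx F -> polynomial_mx (fun u => - F u).
Proof.
move=> pF; apply: polynomial_mx_ext (polynomial_mxZ (-1) pF) => u.
by rewrite scaleN1r.
Qed.

Lemma polynomial_mxM F F' :
  polynomial_mx F -> polynomial_mx F' -> polynomial_mx (fun u => F u * F' u).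
Proof.
move=> pF pF' i j.
have [p Hp] := polynomial_fun_sum (index_enum 'I_n) xpredT
  (fun a => polynomial_funM (pF i a) (pF' a j)).
by exists p => u; rewrite mxE.
Qed.

Lemma polynomial_mxX F k :
  polynomial_mx F -> polynomial_mx (fun u => F u ^+ k).
Proof.
move=> pF; elim: k => [|k IH]; first exact: polynomial_mx_cst.
by apply: polynomial_mx_ext (polynomial_mxM pF IH) => u; rewrite exprS.
Qed.

Lemma polynomial_mx_sum (A : Type) (s : seq A) (P : pred A)
    (F : A -> U -> 'M[C]_n) : (forall a, polynomial_mx (F a)) ->
  polynomial_mx (fun u => \sum_(a <- s | P a) F a u).
Proof.
move=> pF i j.
have [p Hp] := polynomial_fun_sum s P (fun a => pF a i j).
by exists p => u; rewrite summxE.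
Qed.

Lemma polynomial_mx_prod (A : Type) (s : seq A)
    (F : A -> U -> 'M[C]_n) : (forall a, polynomial_mx (F a)) ->
  polynomial_mx (fun u => \prod_(a <- s) F a u).
Proof.
move=> pF; elim: s => [|a s IH].
  by apply: polynomial_mx_ext (polynomial_mx_cst 1) => u; rewrite big_nil.
by apply: polynomial_mx_ext (polynomial_mxM (pF a) IH) => u; rewrite big_cons.
Qed.

Lemma polynomial_texp N F :
  polynomial_mx F -> polynomial_mx (fun u => texp N (F u)).
Proof.
move=> pF; apply: polynomial_mx_sum => a.
exact/polynomial_mxZ/polynomial_mxX.
Qed.

Lemma polynomial_tlog N F :
  polynomial_mx F -> polynomial_mx (fun u => tlog N (F u)).
Proof.
move=> pF; apply: polynomial_mx_sum => a.
apply/polynomial_mxZ/polynomial_mxX/polynomial_mxD => //.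
exact: polynomial_mx_cst.
Qed.

Lemma polynomial_scattered_logs (T : set 'M[C]_n) (I J : finType)
    (rays : seq (I + J)) (lab : I + J -> T -> C) (Xin : U -> I -> 'M[C]_n) :
  (forall i, polynomial_mx (fun u => Xin u i)) ->
  forall j, polynomial_mx (fun u => scattered_logs rays lab (Xin u) j).
Proof.
move=> pX; rewrite /scattered_logs.
elim: #|J| => [|m IH] j; first exact: polynomial_mx_cst.
apply: polynomial_mxN; apply: polynomial_mx_sum => k.
apply: polynomial_mx_prod => r; apply/polynomial_mxZ/polynomial_mxX.
case: r => i; last exact: IH.
exact: polynomial_mxN.
Qed.

End PolynomialFunctions.

(** * Characters in the hull of the incoming labels *)

Section Characters.
Variables (R : realType) (n : nat) (T : set 'M[Cplx R]_n).
Local Notation C := (Cplx R).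

Lemma is_character1 : is_character (fun _ : T => 1).
Proof.
split=> [||x y z _]; last by rewrite mulr1.
- by exists (mpolyC _ 1), 0%N => t; rewrite pevalC expr0 divr1.
- by move=> t; apply: oner_neq0.
Qed.

Lemma is_characterM (chi psi : T -> C) :
  is_character chi -> is_character psi -> is_character (chi \* psi).
Proof.
move=> [[p [e chip]] chi0 chiM] [[q [f psiq]] psi0 psiM]; split.
- exists (p * q), (e + f)%N => t /=.
  by rewrite chip psiq pevalM exprD invfM mulrACA.
- by move=> t /=; rewrite mulf_neq0.
- by move=> x y z xyz /=; rewrite (chiM _ _ _ xyz) (psiM _ _ _ xyz) mulrACA.
Qed.

Definition nat_hull (I : finType) (alpha : I -> T -> C) : set (T -> C) :=
  [set chi | exists m : I -> nat, forall t, chi t = \prod_i alpha i t ^+ m i].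

Section NatHull.
Variables (I : finType) (alpha : I -> T -> C).
Local Notation S := (nat_hull alpha).

Lemma nat_hull1 : S (fun=> 1).
Proof. by exists (fun=> 0%N) => t; rewrite big1. Qed.

Lemma nat_hullM chi psi : S chi -> S psi -> S (chi \* psi).
Proof.
move=> [m chim] [m' psim']; exists (fun i => m i + m' i)%N => t /=.
by rewrite chim psim' -big_split; apply: eq_bigr => i _; rewrite exprD.
Qed.

Lemma nat_hull_gen i : S (alpha i).
Proof.
exists (fun i' => (i' == i : nat)) => t.
rewrite (bigD1 i) //= eqxx expr1 big1 ?mulr1 // => i' /negbTE ->.
by rewrite expr0.
Qed.

Lemma nat_hull_ind (P : (T -> C) -> Prop) : P (fun=> 1) ->
  (forall i chi, P chi -> P (alpha i \* chi)) -> forall chi, S chi -> P chi.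
Proof.
move=> P1 PM chi [m /funext ->]; elim: (index_enum I) => [|i s IH].
  by rewrite (_ : (fun t => _) = fun=> 1) //; apply/funext => t; rewrite big_nil.
rewrite (_ : (fun t => _) = fun t => alpha i t ^+ m i *
    \prod_(j <- s) alpha j t ^+ m j); last first.
  by apply/funext => t; rewrite big_cons.
elim: (m i) => [|a IHa].
  by rewrite (_ : (fun t => _) = fun t => \prod_(j <- s) alpha j t ^+ m j) //;
     apply/funext => t; rewrite mul1r.
rewrite (_ : (fun t => _) = alpha i \* (fun t => alpha i t ^+ a *
    \prod_(j <- s) alpha j t ^+ m j)); first exact: PM.
by apply/funext => t; rewrite exprS /= mulrA.
Qed.

End NatHull.
End Characters.

(** * The solution of a scattering diagram *)

Section Main.
Variables (R : realType) (n : nat) (G T : set 'M[Cplx R]_n).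
Local Notation C := (Cplx R).
Local Notation N := (n * n).+2.
Hypotheses (algG : algebraic_group G) (TG : T `<=` G)
  (T_unit : forall t : T, val t \in unitmx).
Variable D : scattering_diagram G T.

Let S := nat_hull (in_label D).

Definition ray_label (r : incoming D + outgoing D) : T -> C :=
  match r with inl i => in_label D i | inr j => out_label D j end.

(** The linear form is that of a polarization with C_in positive.  The last clause
holds because C_out consists of all the roots in the hull of C_in: a character of
the hull on which l is positive is nontrivial, so it is a root as soon as it has a
nonzero vector in the Lie algebra. *)
Lemma polarizing_form : exists l : (T -> C) -> R,
  [/\ forall chi psi, S chi -> S psi -> l (chi \* psi) = l chi + l psi,
      forall r, S (ray_label r) /\ 0 < l (ray_label r)
    & forall chi X, S chi -> 0 < l chi -> lie_algebra G X -> weight chi X ->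
        X != 0 -> exists j, chi = out_label D j].
Proof.
have [Pp [Pn [[l [lM lroot PpE _]] inPp]]] := in_label_convex D.
have in_root i : root_system G (in_label D i) /\ 0 < l (in_label D i).
  have : Pp (in_label D i) by apply: inPp; exists i.
  by rewrite PpE.
have S_char chi : S chi -> is_character chi /\ 0 <= l chi.
  apply: (nat_hull_ind (P := fun chi => is_character chi /\ 0 <= l chi))
    => [|i psi [cpsi lpsi]].
    split; first exact: is_character1.
    have := lM _ _ (is_character1 T) (is_character1 T).
    rewrite (_ : (fun t => _) = fun=> 1); last by apply/funext => t; rewrite mulr1.
    by move/eqP; rewrite -subr_eq0 opprD addNKr oppr_eq0 => /eqP ->.
  have [[ci _ _] li] := in_root i.
  split; first exact: is_characterM.
  by rewrite lM // addr_ge0 // ltW.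
have SlM chi psi : S chi -> S psi -> l (chi \* psi) = l chi + l psi.
  by move=> /S_char[cchi _] /S_char[cpsi _]; apply: lM.
exists l; split=> //.
  case=> [i|j]; first by split; [apply: nat_hull_gen|case: (in_root i)].
  have : range (out_label D) (out_label D j) by exists j.
  rewrite out_label_range => -[root_j Sj]; split=> //.
  by rewrite lt_neqAle eq_sym lroot //; case: (S_char _ Sj).
move=> chi X Schi chi0 LX wX X0.
suff : range (out_label D) chi by case=> j _ <-; exists j.
rewrite out_label_range; split=> //; split; first by case: (S_char _ Schi).
  move=> chi1; have := form1 (nat_hull1 (in_label D)) SlM.
  by rewrite -chi1 => l0; rewrite l0 ltxx in chi0.
by exists X.
Qed.

Lemma clockwise_rays_uniq : uniq (clockwise_rays D).
Proof. by rewrite sort_uniq enum_uniq. Qed.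

Lemma mem_clockwise_rays r : r \in clockwise_rays D.
Proof. by rewrite mem_sort mem_enum. Qed.

Lemma root_space_nilpotent r X : root_space G (ray_label r) X -> X ^+ N = 0.
Proof.
have [l [lM labP _]] := polarizing_form.
case=> _ wX; have [Sr lr] := labP r.
exact: (positive_weight_nilpotent T_unit (nat_hull1 _) (@nat_hullM _ _ _ _ _)
  lM Sr lr wX).
Qed.

Lemma root_subgroup_log r A : root_subgroup G (ray_label r) A ->
  root_space G (ray_label r) (tlog N A) /\ texp N (tlog N A) = A.
Proof.
case=> X rX; have X0 := root_space_nilpotent rX.
by rewrite (mx_exp_nilpotent X0) => <-; rewrite texpK.
Qed.

Definition in_logs (u : in_decoration D) i := tlog N (val u i).
Definition out_logs (u' : out_decoration D) j := tlog N (val u' j).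

Lemma in_logsP u i :
  root_space G (ray_label (inl i)) (in_logs u i) /\
  texp N (in_logs u i) = val u i.
Proof. exact: (@root_subgroup_log (inl i)) (set_mem (valP u) i). Qed.

Lemma out_logsP u' j :
  root_space G (ray_label (inr j)) (out_logs u' j) /\
  texp N (out_logs u' j) = val u' j.
Proof. exact: (@root_subgroup_log (inr j)) (set_mem (valP u') j). Qed.

Lemma clockwise_productE u u' : clockwise_product u u' =
  \prod_(r <- clockwise_rays D) texp N (ray_logs (in_logs u) (out_logs u') r).
Proof.
apply: eq_bigr => -[i|j] _ /=; last by rewrite (out_logsP u' j).2.
have [rX <-] := in_logsP u i.
have := texpNr (isT : (1 < N)%N) (root_space_nilpotent rX).
set A := texp N _; rewrite -mulmxE => AB.
have [uA _] := mulmx1_unit AB.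
by rewrite -[LHS]mulmx1 -[X in _ *m X]AB mulKmx.
Qed.

Lemma scattered_decoration_subproof u :
  root_subgroup_prod G (out_label D) (fun j =>
    texp N (scattered_logs (clockwise_rays D) ray_label (in_logs u) j)).
Proof.
have [l [lM labP complete]] := polarizing_form.
move=> j; set X := scattered_logs _ _ _ j.
have rX : root_space G (ray_label (inr j)) X.
  apply: (scattered_logs_in_root_space algG TG T_unit (nat_hull1 _)
    (@nat_hullM _ _ _ _ _) lM clockwise_rays_uniq mem_clockwise_rays) => //.
  - exact: out_label_inj.
  - by move=> r; case: (labP r).
  - by move=> r; case: (labP r).
  - by move=> i; case: (in_logsP u i).
by exists X => //; apply: mx_exp_nilpotent; apply: root_space_nilpotent rX.
Qed.

Definition scattered_decoration u : out_decoration D :=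
  SigSub (mem_set (scattered_decoration_subproof u)).

Lemma clockwise_product1P u u' :
  clockwise_product u u' = 1%:M <-> u' = scattered_decoration u.
Proof.
have [l [lM labP complete]] := polarizing_form.
have Slab r : S (ray_label r) by case: (labP r).
have lab_pos r : 0 < l (ray_label r) by case: (labP r).
have inj : injective (fun j => ray_label (inr j)) by exact: out_label_inj.
rewrite clockwise_productE; split=> [P1|->].
  apply: val_inj; apply/funext => j /=.
  have := @product1_scattered _ _ _ T_unit S l (nat_hull1 _)
    (@nat_hullM _ _ _ _ _) lM _ _ _ _ clockwise_rays_uniq mem_clockwise_rays
    inj Slab lab_pos (in_logs u) (out_logs u') _ P1 j.
  rewrite -(out_logsP u' j).2 => -> //.
  case=> i; last by case: (out_logsP u' i) => -[].
  by rewrite /ray_logs -scaleN1r; apply: weightZ; case: (in_logsP u i) => -[].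
rewrite -[1%:M](scattered_product1 algG TG T_unit (nat_hull1 _)
    (@nat_hullM _ _ _ _ _) lM clockwise_rays_uniq mem_clockwise_rays inj Slab
    lab_pos complete (Xin := in_logs u)); last first.
  by move=> i; case: (in_logsP u i).
apply: eq_bigr => -[i|j] _; first exact: erefl.
exact: (out_logsP (scattered_decoration u) j).2.
Qed.

Lemma scattered_decoration_morphism : is_morphism scattered_decoration.
Proof.
move=> j k l.
have polyX i : polynomial_mx (fun u : in_decoration D => mxs_coords (val u))
    (fun u => in_logs u i).
  apply: polynomial_tlog => a b.
  exact: (polynomial_fun_coord _ (i, (a, b))).
have [p Hp] := polynomial_texp N (polynomial_scattered_logs
  (clockwise_rays D) ray_label polyX j) k l.
by exists p, 0%N => u; rewrite expr0 divr1 Hp.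
Qed.

End Main.

Theorem theorem3p39 (R : realType) (n : nat) (G T : set 'M[Cplx R]_n)
    (G_reductive : reductive G) (T_maximal : maximal_torus G T)
    (D : scattering_diagram G T) :
  exists s : in_decoration D -> out_decoration D,
    unique (@is_solution R n G T D) s /\
    forall (u : in_decoration D) (u' : out_decoration D),
      clockwise_product u u' = 1%:M%R <-> u' = s u.
Proof.
have [algG _] := G_reductive; have [[algT _] TG _] := T_maximal.
have T_unit (t : T) : val t \in unitmx.
  have [[F TE] _ _ _] := algT.
  have : T (val t) by apply: set_mem; apply: valP.
  by rewrite {1}TE => -[].
pose s := scattered_decoration algG TG T_unit (D := D).
have sP u u' : clockwise_product u u' = 1%:M <-> u' = s u.
  exact: clockwise_product1P.
exists s; split=> //; split.
  by split=> [|u]; [exact: scattered_decoration_morphism|apply/sP].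
by move=> s' [_ s'P]; apply/funext => u; symmetry; apply/sP.
Qed.
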